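(* Let $n\geq 4$ be an integer and let $p=1+\frac{2}{n}$. Let $(f,g)\in H^1(\mathbb{R}^n)\times L^2(\mathbb{R}^n)$ be real-valued with $\operatorname{supp} f\cup\operatorname{supp} g\subset\{x\in\mathbb{R}^n : |x|\leq 1\}$, and assume that $f\geq 0$ and $g\geq 0$ and that $f$ and $g$ are non-trivial (not identically zero). Then there exist constants $\varepsilon_0>0$ and $C>0$, depending only on $n$, $f$ and $g$ (in particular, $C$ is independent of $\varepsilon$), such that for every $\varepsilon\in(0,\varepsilon_0]$ the following holds: if $u=u(t,x)$ solves the Cauchy problem $$u_{tt}-\Delta u+u_t=|u|^p\quad\text{in } [0,T(\varepsilon))\times\mathbb{R}^n,\qquad u(0,x)=\varepsilon f(x),\quad u_t(0,x)=\varepsilon g(x),\quad x\in\mathbb{R}^n,$$ on $[0,T(\varepsilon))$, then $$T(\varepsilon)\leq \exp\left(C\varepsilon^{-\frac{2}{n}}\right).$$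
   Context: The unknown $u$ is real-valued, and $\Delta$ is the Laplacian in $x\in\mathbb{R}^n$. The parameter $\varepsilon>0$ represents the smallness of the initial data. $T(\varepsilon)$ is the lifespan of the solution: $[0,T(\varepsilon))$ is the time interval on which the solution $u$ of the Cauchy problem with data $(\varepsilon f,\varepsilon g)$ exists. Solutions are understood in the energy class appropriate to the data: $u\in C([0,T(\varepsilon));H^1(\mathbb{R}^n))\cap C^1([0,T(\varepsilon));L^2(\mathbb{R}^n))$, satisfying the equation in the sense of distributions and attaining the initial data, with finite speed of propagation, i.e. $\operatorname{supp} u(t,\cdot)\subset\{x\in\mathbb{R}^n:|x|\leq t+1\}$ for $0\leq t<T(\varepsilon)$. *)

(* Defs.v *)
From HB Require Import structures.
From mathcomp Require Import all_boot all_order all_algebra.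
From mathcomp Require Import all_classical all_reals all_analysis.

Set Implicit Arguments.
Unset Strict Implicit.
Unset Printing Implicit Defensive.
Import Order.TTheory GRing.Theory Num.Theory.
Import numFieldNormedType.Exports.

Local Open Scope classical_set_scope.
Local Open Scope ring_scope.

(** R^n is ['rV[R]_n].  The library gives it its normed (sup norm) topology but
    no sigma-algebra and no Lebesgue measure; we equip it with the sigma-algebra
    generated by the coordinates, as the library does for [n.-tuple]. *)
Section RnMeasurable.
Variables (R : realType) (n : nat).

Definition coord (i : 'I_n) (v : 'rV[R]_n) : measurableTypeR R := v 0 i.

Let rV_set0 : g_sigma_preimage coord set0.
Proof. exact: sigma_algebra0. Qed.

Let rV_setC A : g_sigma_preimage coord A -> g_sigma_preimage coord (~` A).
Proof. exact: sigma_algebraC. Qed.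

Let rV_bigcup (F : (set 'rV[R]_n)^nat) :
  (forall i, g_sigma_preimage coord (F i)) ->
  g_sigma_preimage coord (\bigcup_i (F i)).
Proof. exact: sigma_algebra_bigcup. Qed.

HB.instance Definition _ := @isMeasurable.Build default_measure_display
  'rV[R]_n (g_sigma_preimage coord) rV_set0 rV_setC rV_bigcup.

End RnMeasurable.

Section RnMeasure.
Variable R : realType.

Definition rVcons n (z : measurableTypeR R * 'rV[R]_n) : 'rV[R]_n.+1 :=
  row_mx (z.1)%:M z.2 : 'rV[R]_(1 + n).

Definition rVuncons n (v : 'rV[R]_n.+1) : measurableTypeR R * 'rV[R]_n :=
  (v 0 0, \row_i v 0 (lift ord0 i)).

Lemma measurable_coord n (i : 'I_n) :
  measurable_fun [set: 'rV[R]_n] (@coord R n i).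
Proof.
move=> _ Y mY; rewrite setTI; apply: sub_sigma_algebra => /=.
rewrite -bigcup_seq/=; exists i => /=; first by rewrite mem_index_enum.
by exists Y => //; rewrite setTI.
Qed.

Lemma measurable_fun_rV d (T : measurableType d) n (f : T -> 'rV[R]_n) :
  (forall i, measurable_fun [set: T] (@coord R n i \o f)) ->
  measurable_fun [set: T] f.
Proof.
move=> mf _ A; rewrite setTI.
suff : g_sigma_preimage (@coord R n) `<=` [set B | measurable (f @^-1` B)].
  exact.
apply: smallest_sub; first split => /=.
- by rewrite preimage_set0.
- by move=> B mB; rewrite setTD -preimage_setC; exact: measurableC.
- by move=> F mF; rewrite preimage_bigcup; exact: bigcup_measurable.
rewrite -bigcup_seq => B [i _] [C mC <-] /=.
by rewrite setTI -comp_preimage -[X in measurable X]setTI; exact: mf.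
Qed.

Lemma rVcons0 n z : @rVcons n z 0 0 = z.1.
Proof.
rewrite /rVcons (_ : 0 = lshift n (0 : 'I_1)); last exact/val_inj.
by rewrite (row_mxEl ((z.1)%:M : 'M[R]_1)) mxE eqxx.
Qed.

Lemma rVconsS n z i : @rVcons n z 0 (lift ord0 i) = z.2 0 i.
Proof.
rewrite /rVcons (_ : lift ord0 i = rshift 1 i); last exact/val_inj.
by rewrite (row_mxEr ((z.1)%:M : 'M[R]_1)).
Qed.

Lemma rVconsK n : cancel (@rVcons n) (@rVuncons n).
Proof.
move=> [x v]; rewrite /rVuncons rVcons0/=; congr pair.
by apply/rowP => i; rewrite mxE rVconsS.
Qed.

Lemma measurable_rVcons n : measurable_fun [set: _] (@rVcons n).
Proof.
apply: measurable_fun_rV => i; case: (unliftP ord0 i) => [j|] ->.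
- rewrite (_ : _ \o _ = coord j \o snd).
    by apply: measurableT_comp => //; exact: measurable_coord.
  by apply/funext => z; rewrite /= /coord rVconsS.
- rewrite (_ : _ \o _ = fst)//.
  by apply/funext => z; rewrite /= /coord rVcons0.
Qed.

Lemma measurable_rVuncons n : measurable_fun [set: _] (@rVuncons n).
Proof.
apply: measurable_fun_pair; first exact: measurable_coord.
apply: measurable_fun_rV => i.
rewrite (_ : _ \o _ = coord (lift ord0 i)); first exact: measurable_coord.
by apply/funext => v; rewrite /= /coord mxE.
Qed.

Section lebesgue_rV_step.
Variables (n : nat) (m : {sigma_finite_measure set 'rV[R]_n -> \bar R}).

Definition lebesgue_rVS : set 'rV[R]_n.+1 -> \bar R :=
  pushforward (@lebesgue_measure R \x m)%E (@rVcons n).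

Let preimage_rVcons A : measurable A -> measurable (@rVcons n @^-1` A).
Proof.
by move=> mA; rewrite -[X in measurable X]setTI; exact: measurable_rVcons.
Qed.

Let lebesgue_rVS0 : lebesgue_rVS set0 = 0%E.
Proof. by rewrite /lebesgue_rVS /pushforward preimage_set0 measure0. Qed.

Let lebesgue_rVS_ge0 A : (0 <= lebesgue_rVS A)%E.
Proof. by rewrite /lebesgue_rVS /pushforward measure_ge0. Qed.

Let lebesgue_rVS_sigma_additive : semi_sigma_additive lebesgue_rVS.
Proof.
move=> F mF tF mUF; rewrite /lebesgue_rVS /pushforward preimage_bigcup.
apply: measure_semi_sigma_additive.
- by move=> k; exact: preimage_rVcons.
- apply/trivIsetP => /= i j _ _ ij; rewrite -preimage_setI.
  by move/trivIsetP : tF => /(_ _ _ _ _ ij) ->//; rewrite preimage_set0.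
- by rewrite -preimage_bigcup; exact: preimage_rVcons.
Qed.

HB.instance Definition _ := isMeasure.Build _ _ _ lebesgue_rVS
  lebesgue_rVS0 lebesgue_rVS_ge0 lebesgue_rVS_sigma_additive.

Let lebesgue_rVS_sigma_finite : sigma_finite setT lebesgue_rVS.
Proof.
have /sigma_finiteP[F [TF ndF Foo]] := sigma_finiteT (@lebesgue_measure R).
have /sigma_finiteP[G [TG ndG Goo]] := sigma_finiteT m.
exists (fun k => @rVuncons n @^-1` (F k `*` G k)).
  rewrite -preimage_bigcup (_ : \bigcup_k _ = setT) ?preimage_setT//.
  apply/seteqP; split=> // -[x v] _.
  have [i _ Fx] : (\bigcup_i F i) x by rewrite -TF.
  have [j _ Gv] : (\bigcup_j G j) v by rewrite -TG.
  exists (maxn i j) => //; split => /=.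
  - by move: x Fx; exact/subsetPset/ndF/leq_maxl.
  - by move: v Gv; exact/subsetPset/ndG/leq_maxr.
move=> k; have [mF Fk] := Foo k; have [mG Gk] := Goo k; split.
  rewrite -[X in measurable X]setTI.
  by apply: measurable_rVuncons => //; exact: measurableX.
rewrite /lebesgue_rVS /pushforward (_ : _ @^-1` _ = F k `*` G k); last first.
  rewrite -comp_preimage (_ : _ \o _ = id)//.
  by apply/funext => z; exact: rVconsK.
by rewrite product_measure1E// lte_mul_pinfty// ge0_fin_numE.
Qed.

HB.instance Definition _ := Measure_isSigmaFinite.Build _ _ _ lebesgue_rVS
  lebesgue_rVS_sigma_finite.

End lebesgue_rV_step.

Fixpoint lebesgue_rV n : {sigma_finite_measure set 'rV[R]_n -> \bar R} :=
  match n with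
  | 0 => \d_ (0 : 'rV[R]_0)
  | k.+1 => lebesgue_rVS (lebesgue_rV k)
  end.

Lemma lebesgue_rV_box n (A : 'I_n -> set (measurableTypeR R)) :
  (forall i, measurable (A i)) ->
  lebesgue_rV n [set v | forall i, A i (v 0 i)] =
  (\prod_i lebesgue_measure (A i))%E.
Proof.
elim: n A => [|n IHn] A mA.
  rewrite big_ord0 /= diracE (_ : _ \in _)//.
  by rewrite inE => -[].
rewrite big_ord_recl -IHn//.
rewrite -[LHS]/((@lebesgue_measure R \x lebesgue_rV n)%E (@rVcons n @^-1` _)).
rewrite (_ : @rVcons n @^-1` _ =
    A ord0 `*` [set v : 'rV[R]_n | forall i, A (lift ord0 i) (v 0 i)]); last first.
  apply/seteqP; split=> [z Az|z [Az0 Az] i]; last first.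
    by case: (unliftP ord0 i) => [j|] ->; rewrite ?rVcons0 ?rVconsS.
  split; first by have := Az ord0; rewrite rVcons0.
  by move=> i; have := Az (lift ord0 i); rewrite rVconsS.
rewrite product_measure1E//.
rewrite (_ : mkset _ =
    \bigcap_(i in [set: 'I_n]) (coord i @^-1` A (lift ord0 i))); last first.
  by apply/seteqP; split=> [v Av i _|v Av i]; [exact: Av|exact: (Av i Logic.I)].
apply: fin_bigcap_measurable => // i _; rewrite -[X in measurable X]setTI.
exact: measurable_coord.
Qed.

End RnMeasure.

Section Distributions.
Variable R : realType.

Definition enorm n (x : 'rV[R]_n) : R := Num.sqrt (\sum_i x 0 i ^+ 2).

(** The norm of ['rV[R]_n] is the sup norm, hence the separate Euclidean norm
    [enorm].  C^k is expressed by the existence and continuity of all iterated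
    directional derivatives of order at most k. *)
Fixpoint Ck (V : normedModType R) (k : nat) (phi : V -> R) : Prop :=
  match k with
  | 0 => continuous phi
  | k'.+1 => continuous phi /\
      forall v, (forall x, derivable phi x v) /\ Ck k' ('D_v phi)
  end.

Definition smooth (V : normedModType R) (phi : V -> R) := forall k, Ck k phi.

Definition supp (V : normedModType R) (phi : V -> R) : set V :=
  closure [set x | phi x != 0].

Definition test_function (V : normedModType R) (Omega : set V) (phi : V -> R) :=
  [/\ smooth phi, compact (supp phi) & supp phi `<=` Omega].

Variable n : nat.
Local Notation mu := (lebesgue_rV R n).
Implicit Types f g : 'rV[R]_n -> R.

(** Support of (the almost-everywhere class of) a function: the complement of
    the largest open set on which it vanishes almost everywhere. *)
Definition ess_supp f : set 'rV[R]_n :=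
  ~` \bigcup_(U in [set U | open U /\ {ae mu, forall x, U x -> f x = 0}]) U.

Definition axis (i : 'I_n) : 'rV[R]_n := delta_mx 0 i.

Definition is_weak_partial (i : 'I_n) f g :=
  forall phi : 'rV[R]_n -> R, test_function setT phi ->
    \int[mu]_x (f x * 'D_(axis i) phi x) = - \int[mu]_x (g x * phi x).

Definition L2 : set ('rV[R]_n -> R) := [set f | f \in Lfun mu 2%:E].

Definition H1 : set ('rV[R]_n -> R) :=
  [set f | L2 f /\ forall i, exists2 g, L2 g & is_weak_partial i f g].

(** Unique up to a null set for [f] in [H1]; [0] if there is no weak partial
    derivative in L^2. *)
Definition weak_partial (i : 'I_n) f : 'rV[R]_n -> R :=
  xget (fun=> 0) [set g | L2 g /\ is_weak_partial i f g].

Definition L2norm f : \bar R := 'N[mu]_2%:E[EFin \o f]%E.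

Definition H1norm f : \bar R :=
  ((L2norm f ^+ 2 + \sum_(i < n) L2norm (weak_partial i f) ^+ 2) `^ 2^-1)%E.

End Distributions.

Section Cauchy.
Variables (R : realType) (n : nat).
Local Notation mu := (lebesgue_rV R n).
Implicit Types (T : \bar R) (u : R -> 'rV[R]_n -> R).

Definition time_interval T : set R := [set t | 0 <= t /\ (t%:E < T)%E].

(** [u] belongs to C([0, T); X), where X is the space of the functions in [D]
    with the norm [N]. *)
Definition continuous_curve (D : set ('rV[R]_n -> R))
    (N : ('rV[R]_n -> R) -> \bar R) T u :=
  forall t, time_interval T t -> D (u t) /\
    N (u s \- u t) @[s --> within (time_interval T) (nbhs t)] --> 0%E.

(** [v] is the derivative of [u] in the sense of curves in L^2; the derivative
    at time 0 is one-sided. *)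
Definition L2_derivative T u (v : R -> 'rV[R]_n -> R) :=
  forall t, time_interval T t ->
    L2norm (fun x => (s - t)^-1 * (u s x - u t x) - v t x)
      @[s --> within (time_interval T) t^'] --> 0%E.

Definition C1_L2 T u v :=
  [/\ continuous_curve (@L2 R n) (@L2norm R n) T u,
      continuous_curve (@L2 R n) (@L2norm R n) T v & L2_derivative T u v].

Definition dt : R * 'rV[R]_n := (1, 0).
Definition dx (i : 'I_n) : R * 'rV[R]_n := (0, axis R i).

Definition laplacian (phi : R * 'rV[R]_n -> R) (z : R * 'rV[R]_n) : R :=
  \sum_(i < n) 'D_(dx i) ('D_(dx i) phi) z.

(** u_tt - Delta u + u_t = |u|^p in the sense of distributions on
    (0, T) x R^n.  The double integrals are iterated, so that they depend only
    on the almost-everywhere classes of the [u t] and no joint measurability of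
    [u] is needed. *)
Definition damped_wave_eq (p : R) T u :=
  forall phi : R * 'rV[R]_n -> R,
    test_function [set z | 0 < z.1 /\ (z.1%:E < T)%E] phi ->
    \int[lebesgue_measure]_(t in time_interval T) \int[mu]_x
      (u t x * ('D_dt ('D_dt phi) (t, x) - laplacian phi (t, x)
                - 'D_dt phi (t, x))) =
    \int[lebesgue_measure]_(t in time_interval T) \int[mu]_x
      (`|u t x| `^ p * phi (t, x)).

Definition solves_cauchy (p : R) (u0 u1 : 'rV[R]_n -> R) T u :=
  [/\ (0 < T)%E,
      continuous_curve (@H1 R n) (@H1norm R n) T u,
      exists v, [/\ C1_L2 T u v, {ae mu, forall x, u 0 x = u0 x}
                  & {ae mu, forall x, v 0 x = u1 x}],
      damped_wave_eq p T u
    & forall t, time_interval T t ->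
        ess_supp (u t) `<=` [set x | enorm x <= t + 1]].

End Cauchy.

(* Main.v *)
Require Import Defs.
From HB Require Import structures.
From mathcomp Require Import all_boot all_order all_algebra.
From mathcomp Require Import all_classical all_reals all_analysis.
From mathcomp Require Import measurable_realfun ring lra.

Set Implicit Arguments.
Unset Strict Implicit.
Unset Printing Implicit Defensive.
Import Order.TTheory GRing.Theory Num.Theory.
Import numFieldNormedType.Exports.

Local Open Scope classical_set_scope.
Local Open Scope ring_scope.

(** Why solutions cannot live longer than [exp (C eps ^ (- 2 / n))].

    Test the equation against
      [psi r (t, x) = zeta (t / r^2) * \prod_i zeta (x_i / r)],
    where [zeta = eta ^ (n + 2)] and [eta] is an even smooth plateau, equal to 1
    on [-1, 1] and to 0 outside (-2, 2).  Let [X r] be the integral of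
    [|u|^p psi r] over space-time and [I > 0] a lower bound, over all large
    dyadic [r], for the integral of [(f + g) psi r] at time 0.  Integrating by parts,
      [X r + eps I <= \int u (psi_tt - Delta psi - psi_t)].
    The adjoint operator applied to [psi r] is [O(r^-2) eta^n], because the
    exponent [n + 2] leaves [n] powers of [eta] after two derivatives, and it
    lives outside the box where [psi r = 1], hence where [psi (r / 2) = 0].
    As [(eta^n)^p = eta^(n+2)] for [p = 1 + 2 / n], Young's inequality bounds the
    right-hand side by
      [(C / r^2) (th (X r - X (r / 2)) + th^(-n/2) r^(n+2))]
    for every [th > 0] ([wave_op_young], [wave_ineq]).  At the critical exponent
    the powers of [r] disappear after rescaling [th] ([rescale_young]), and
    optimising [th] gives, with [S r = eps I / 2 + X r],
      [c (S r) ^ (1 + 2 / n) <= S r - S (r / 2)]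
    ([young_optimize]).  Along [r = 2 ^ j] this is an implicit Euler scheme for
    [S' = c S ^ (1 + 2 / n)]; by convexity each step lowers [S ^ (- 2 / n)] by a
    fixed amount ([backward_euler_bound]), so that at most [O(eps ^ (- 2 / n))]
    steps are possible.  The step at scale [r] is available as long as
    [2 r^2 < T], whence [log T = O(eps ^ (- 2 / n))] ([lifespan_steps]).

    Test functions must vanish near time 0, so [psi r] is multiplied by a
    nondecreasing [onset de t] that rises from 0 to 1 on [de, 2 de].  No limit
    in [de] is taken: the same small [de] is used at the finitely many scales,
    and the terms carrying the derivative of the onset, an average over
    [de, 2 de] of [\int (u_t + u) psi r], are still at least
    [eps I / 2]
    ([initial_layers]).  All space-time integrals are iterated; their time
    integrands are continuous because [u] and [u_t] are continuous in L^2 and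
    [p <= 2] ([powR_cvg]). *)

(** * Functions of class C^k *)

Section CkTheory.
Variables (R : realType) (V : normedModType R).
Implicit Types (f g : V -> R) (h : R -> R) (k : nat).

Lemma Ck_pred k f : Ck k.+1 f -> Ck k f.
Proof.
elim: k f => [f []//|k IHk f [cf df]]; split=> // v.
by have [dvf ?] := df v; split=> //; exact: IHk.
Qed.

(** The derivatives are usually known through [is_derive], from which both the
    derivability and the value of the next derivative are read off. *)
Lemma CkS k f (df : V -> V -> R) : continuous f ->
  (forall v x, is_derive x v f (df v x)) -> (forall v, Ck k (df v)) ->
  Ck k.+1 f.
Proof.
move=> cf fdf Ckdf; split=> // v; split=> [x|]; first exact: ex_derive.
rewrite (_ : 'D_v f = df v)//; apply/funext => x; exact: derive_val.
Qed.

Lemma Ck_cst k (c : R) : Ck k (fun _ : V => c).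
Proof.
elim: k c => [c|k IHk c]; first by move=> x; exact: cvg_cst.
apply: (@CkS _ _ (fun _ _ => 0)) => //.
by move=> x; exact: cvg_cst.
Qed.

Lemma CkD k f g : Ck k f -> Ck k g -> Ck k (fun x => f x + g x).
Proof.
elim: k f g => [f g cf cg x|k IHk f g [cf df] [cg dg]].
  by apply: cvgD; [exact: cf|exact: cg].
apply: (@CkS _ _ (fun v x => 'D_v f x + 'D_v g x)).
- by move=> x; apply: cvgD; [exact: cf|exact: cg].
- move=> v x; have [dvf _] := df v; have [dvg _] := dg v.
  by apply: is_deriveD; exact: derivableP.
- by move=> v; apply: IHk; [case: (df v)|case: (dg v)].
Qed.

Lemma CkM k f g : Ck k f -> Ck k g -> Ck k (fun x => f x * g x).
Proof.
elim: k f g => [f g cf cg x|k IHk f g Cf Cg].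
  by apply: cvgM; [exact: cf|exact: cg].
have [[cf df] [cg dg]] := (Cf, Cg).
apply: (@CkS _ _ (fun v x => f x * 'D_v g x + g x * 'D_v f x)).
- by move=> x; apply: cvgM; [exact: cf|exact: cg].
- move=> v x; have [dvf _] := df v; have [dvg _] := dg v.
  by apply: is_deriveM; exact: derivableP.
- move=> v; apply: CkD; apply: IHk; try exact: Ck_pred.
    by case: (dg v).
  by case: (df v).
Qed.

Lemma Ck_prod k (I : Type) (s : seq I) (F : I -> V -> R) :
  (forall i, Ck k (F i)) -> Ck k (fun x => \prod_(i <- s) F i x).
Proof.
move=> CF; elim: s => [|i s IHs].
  rewrite (_ : (fun x => _) = fun=> 1); first exact: Ck_cst.
  by apply/funext => x; rewrite big_nil.
rewrite (_ : (fun x => _) = fun x => F i x * \prod_(j <- s) F j x).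
  exact: CkM.
by apply/funext => x; rewrite big_cons.
Qed.

(** A one-dimensional outer function only sees the line through [x] directed by
    [v], so directional derivability of [g] suffices: restrict to that line and
    use the chain rule on the real line. *)
Lemma is_derive_compR h g (x v : V) (dh dg : R) :
  is_derive (g x) 1 h dh -> is_derive x v g dg ->
  is_derive x v (fun y => h (g y)) (dh * dg).
Proof.
(* Both sides are the limit of the same difference quotient. *)
have line (f : V -> R) : 'D_v f x = (fun r : R => f (r *: v + x))^`()%classic 0.
  rewrite /derive1 /derive; set a := (X in lim (X @ _)); set b := (X in _ = lim (X @ _)).
  suff -> : a = b by []. apply/funext => r; rewrite /a /b /=.
  by rewrite scale0r add0r addr0.
move=> [dh' <-] [dg' <-].
have g0 : g x = g (0 *: v + x) by rewrite scale0r add0r.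
have dg1 := dg'; rewrite derivable1P in dg1.
have dh1 := dh'; rewrite g0 in dh1.
split.
  apply/derivable1P; apply/derivable1_diffP.
  by apply: differentiable_comp; exact/derivable1_diffP.
by rewrite !line (derive1_comp dg1 dh1) -g0 derive1E.
Qed.

Lemma Ck_comp k h g : Ck k h -> Ck k g -> Ck k (fun x => h (g x)).
Proof.
elim: k h g => [h g ch cg x|k IHk h g Ch Cg].
  by apply: continuous_comp; [exact: cg|exact: ch].
have [[ch dh] [cg dg]] := (Ch, Cg).
apply: (@CkS _ _ (fun v x => 'D_1 h (g x) * 'D_v g x)).
- by move=> x; apply: continuous_comp; [exact: cg|exact: ch].
- move=> v x; apply: is_derive_compR; apply: derivableP.
    by case: (dh 1) => H _; exact: H.
  by case: (dg v) => H _; exact: H.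
- move=> v; apply: CkM; last by case: (dg v).
  by apply: (IHk ('D_1 h)); [case: (dh 1)|exact: Ck_pred].
Qed.

(** A linear form is its own derivative, constantly in the base point. *)
Lemma Ck_linear k f : continuous f ->
  (forall (r : R) v x, f (r *: v + x) = r * f v + f x) -> Ck k f.
Proof.
move=> cf lf; case: k => [//|k].
apply: (@CkS _ _ (fun v _ => f v)) => //; last by move=> v; exact: Ck_cst.
move=> v x.
have H : (fun r : R => r^-1 *: ((f \o shift x) (r *: v) - f x)) @ 0^' --> f v.
  apply: cvg_near_cst; near=> r.
  rewrite /= lf addrK [_ *: _]mulrA mulVf ?mul1r//.
  by near: r; exact: nbhs_dnbhs_neq.
by split; [apply: cvgP H|apply: cvg_lim H].
Unshelve. all: by end_near. Qed.

End CkTheory.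

Section Ck1.
Variable R : realType.

(** On the line the derivatives in all directions are multiples of one. *)
Lemma Ck1S k (h dh : R -> R) : (forall x : R, is_derive x 1 h (dh x)) -> Ck k dh ->
  Ck k.+1 h.
Proof.
move=> hdh Ckdh.
apply: (@CkS _ _ _ _ (fun v x => dh x * v)).
- move=> x; apply/differentiable_continuous/derivable1_diffP; exact: ex_derive.
- by move=> v x; apply: (@is_derive_compR _ _ h id); exact: is_derive_id.
- by move=> v; apply: CkM => //; exact: Ck_cst.
Qed.

Lemma Ck_id k : Ck k (fun x : R => x).
Proof.
case: k => [|k]; first by move=> x; exact: cvg_id.
by apply: (@Ck1S _ _ (fun=> 1)); exact: Ck_cst.
Qed.

Lemma smooth_derive1 (h : R -> R) : smooth h -> smooth h^`()%classic.
Proof.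
move=> sh k; have [_ /(_ 1)[_ Ckh]] := sh k.+1.
by rewrite (_ : h^`()%classic = 'D_1 h)//; apply/funext => x; rewrite derive1E.
Qed.

Lemma smooth_is_derive (h : R -> R) : smooth h ->
  forall x : R, is_derive x 1 h (h^`()%classic x).
Proof.
move=> sh x; have [_ /(_ 1)[dh _]] := sh 1%N.
by rewrite derive1E; exact: derivableP.
Qed.

End Ck1.

Section CkCoord.
Variables (R : realType) (n : nat).

Lemma Ck_fst k : Ck k (fun z : R * 'rV[R]_n => z.1).
Proof. by apply: Ck_linear => // z; exact: cvg_fst. Qed.

Lemma Ck_coord k (i : 'I_n) : Ck k (fun z : R * 'rV[R]_n => z.2 0 i).
Proof.
apply: Ck_linear => [z|r v x]; last by rewrite !mxE.
apply: (@continuous_comp _ _ _ snd (fun v : 'rV[R]_n => v 0 i)).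
  exact: cvg_snd.
exact: coord_continuous.
Qed.

End CkCoord.

(** * A smooth plateau *)

Section Bump.
Variable R : realType.
Implicit Types (x s : R) (k m : nat).

(** The span of the family is closed under differentiation, so the smoothness of
    [exp (- 1 / x)] becomes an induction that mentions no polynomial. *)
Definition flat k x : R := if 0 < x then x^-1 ^+ k * expR (- x^-1) else 0.

Lemma flat0 k x : x <= 0 -> flat k x = 0.
Proof. by rewrite /flat leNgt => /negbTE ->. Qed.

Lemma flat_ge0 k x : 0 <= flat k x.
Proof.
rewrite /flat; case: ifP => // x0.
by rewrite mulr_ge0 ?expR_ge0// exprn_ge0// invr_ge0 ltW.
Qed.

(** From [exp y = exp (y / (k + 1)) ^ (k + 1)] and [1 + z <= exp z]. *)
Lemma exprn_expRN_le k (y : R) : 0 <= y -> y ^+ k * expR (- y) <= k.+1%:R ^+ k.+1.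
Proof.
move=> y0; have k0 : 0 < k.+1%:R :> R by rewrite ltr0n.
have e : expR y = expR (y / k.+1%:R) ^+ k.+1.
  by rewrite -expRM_natl mulrC divfK// gt_eqF.
have H : (y / k.+1%:R) ^+ k <= expR y.
  rewrite e exprS -[leLHS]mul1r ler_pM//.
  - by rewrite exprn_ge0// divr_ge0// ltW.
  - by rewrite -expR0 ler_expR divr_ge0// ltW.
  - rewrite lerXn2r ?nnegrE ?expR_ge0//; first by rewrite divr_ge0// ltW.
    by apply: le_trans (expR_ge1Dx _); rewrite lerDr.
have -> : y ^+ k = k.+1%:R ^+ k * (y / k.+1%:R) ^+ k.
  by rewrite -exprMn mulrC divfK// gt_eqF.
rewrite expRN exprSr -mulrA ler_pM//.
- by rewrite mulr_ge0 ?invr_ge0 ?expR_ge0// exprn_ge0// divr_ge0.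
- by rewrite ler_pdivrMr ?expR_gt0//; apply: (le_trans H); rewrite ler_peMl ?expR_ge0// ler1n.
Qed.

Lemma is_derive_flat k x :
  is_derive x 1 (flat k) (flat k.+2 x - k%:R * flat k.+1 x).
Proof.
have [x0|x0|->] := ltgtP x 0.
- rewrite !flat0 ?(ltW x0)// mulr0 subr0.
  apply: (@near_eq_is_derive _ _ _ (cst 0)).
  near=> y; rewrite /= flat0// ltW//.
  by near: y; exact: lt_nbhsl.
- have xn0 : x != 0 by rewrite gt_eqF.
  have dV : is_derive x (1 : R) (fun y : R => y^-1) (- x ^- 2).
    by apply: is_derive_eq; first exact: is_deriveV; rewrite [_ *: _]mulr1.
  have dE (z : R) : is_derive z (1 : R) (fun y => expR (- y)) (- expR (- z)).
    rewrite -mulrN1; by apply: (@is_derive_compR R R expR -%R).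
  have dX (z : R) : is_derive z (1 : R) (fun y : R => y ^+ k) (k%:R * z ^+ k.-1).
    have := @is_deriveX R R id k z 1 1 (is_derive_id _ _).
    by rewrite [_ *: _]mulr1 exprfctE.
  have dG (z : R) : is_derive z (1 : R) (fun y => y ^+ k * expR (- y))
      (z ^+ k * - expR (- z) + expR (- z) * (k%:R * z ^+ k.-1)).
    exact: is_deriveM.
  apply: (@near_eq_is_derive R R R (fun y => y^-1 ^+ k * expR (- y^-1))).
    near=> y; rewrite /flat ifT//.
    by near: y; exact: lt_nbhsr.
  apply: is_derive_eq; first exact: (@is_derive_compR R R _ _ _ _ _ _ (dG _) dV).
  rewrite /flat x0 -exprVn; move: (expR _) => e; move: (x^-1) => a.
  case: k {dX dG} => [|k] /=; rewrite ?exprS; ring.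
(* At 0 the quotient [flat k r / r] is [r * flat (k + 2) r], a bounded function
   times [r]. *)
- rewrite !flat0// mulr0 subr0.
  have flatS y : flat k y = y ^+ 2 * flat k.+2 y.
    rewrite /flat; case: ifPn => [y0|_]; last by rewrite mulr0.
    have yn0 : y != 0 by rewrite gt_eqF.
    by rewrite !exprS mulrA; field.
  have flatle y : flat k.+2 y <= k.+3%:R ^+ k.+3.
    rewrite /flat; case: ifPn => [y0|_]; last by rewrite exprn_ge0.
    by apply: exprn_expRN_le; rewrite invr_ge0 ltW.
  have H : (fun r : R => r^-1 *: ((flat k \o shift (0:R)) (r *: (1:R)) - flat k 0))
      @ 0^' --> (0:R).
    apply/cvgr0Pnorm_le => e e0; near=> r.
    have r0 : r != 0 by near: r; exact: nbhs_dnbhs_neq.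
    rewrite /= (@flat0 _ 0)// subr0 addr0 [_ *: 1]mulr1 flatS.
    rewrite [_ *: _]mulrA expr2 mulrA mulVf// mul1r normrM.
    rewrite [X in _ * X]ger0_norm ?flat_ge0//.
    apply: (@le_trans _ _ (e / k.+3%:R ^+ k.+3 * k.+3%:R ^+ k.+3)); last first.
      by rewrite divfK// expf_neq0// pnatr_eq0.
    rewrite ler_pM ?flat_ge0//.
    near: r; apply: dnbhs0_le.
    by rewrite divr_gt0// exprn_gt0.
  by split; [apply: cvgP H|apply: cvg_lim H].
Unshelve. all: by end_near. Qed.

Lemma smooth_flat k : smooth (flat k).
Proof.
move=> m; elim: m k => [|m IHm] k.
  move=> x; apply/differentiable_continuous/derivable1_diffP.
  by have [] := is_derive_flat k x.
apply: (Ck1S (is_derive_flat k)); apply: CkD => //.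
rewrite (_ : (fun x => _) = fun x => (- k%:R) * flat k.+1 x).
  by apply: CkM => //; exact: Ck_cst.
by apply/funext => x; rewrite mulNr.
Qed.

End Bump.

(** A composition of two copies of [flat 0] avoids any quotient: the inner term
    [expR 1 * flat 0 (1 - s)] is at least 1 for [s <= 0] and vanishes for
    [1 <= s], and [flat 0 1 = expR (- 1)] explains the factors [expR 1]. *)
HB.lock Definition step (R : realType) (s : R) : R :=
  expR 1 * flat 0 (1 - expR 1 * flat 0 (1 - s)).

Section Step.
Variable R : realType.
Implicit Types (x s : R) (k m : nat).

Lemma stepE : @step R = fun s => expR 1 * flat 0 (1 - expR 1 * flat 0 (1 - s)).
Proof. by apply/funext => s; rewrite step.unlock. Qed.

Lemma flat01 : flat 0 1 = expR (- 1) :> R.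
Proof. by rewrite /flat ltr01 mul1r invr1. Qed.

Lemma flat_le0 (x y : R) : x <= y -> flat 0 x <= flat 0 y.
Proof.
move=> xy; rewrite /flat !mul1r; case: ifP => x0; case: ifP => y0 //.
- by rewrite ler_expR lerN2 lef_pV2.
- by rewrite (lt_le_trans x0 xy) in y0.
Qed.

Lemma step_le0 s : s <= 0 -> step s = 0.
Proof.
move=> s0; rewrite stepE flat0 ?mulr0// subr_le0.
rewrite -[leLHS](expRxMexpNx_1 1) ler_wpM2l ?expR_ge0// -flat01 flat_le0//.
by rewrite lerBrDr -lerBrDl subrr.
Qed.

Lemma step_ge1 s : 1 <= s -> step s = 1.
Proof.
move=> s1; rewrite stepE (@flat0 _ 0 (1 - s)) ?subr_le0// mulr0 subr0 flat01.
by rewrite expRxMexpNx_1.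
Qed.

Lemma step_ge0 s : 0 <= step s.
Proof. by rewrite stepE mulr_ge0 ?expR_ge0 ?flat_ge0. Qed.

Lemma step_le1 s : step s <= 1.
Proof.
rewrite stepE -[leRHS](expRxMexpNx_1 1) ler_wpM2l ?expR_ge0// -flat01 flat_le0//.
by rewrite gerBl mulr_ge0 ?expR_ge0 ?flat_ge0.
Qed.

Lemma smooth_step : smooth (@step R).
Proof.
move=> k; rewrite stepE; apply: CkM; first exact: Ck_cst.
apply: (@Ck_comp R R k (@flat R 0) _ (@smooth_flat R 0 k)).
rewrite (_ : (fun x => _) = fun s => 1 + (- expR 1) * flat 0 (1 + (-1) * s)).
  apply: CkD; first exact: Ck_cst.
  apply: CkM; first exact: Ck_cst.
  apply: (@Ck_comp R R k (@flat R 0) _ (@smooth_flat R 0 k)).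
  apply: CkD; first exact: Ck_cst.
  by apply: CkM; [exact: Ck_cst|exact: Ck_id].
by apply/funext => s; rewrite mulN1r mulNr.
Qed.

Lemma step_derive_ge0 s : 0 <= (@step R)^`()%classic s.
Proof.
have dflat x : is_derive x (1 : R) (@flat R 0) (flat 2 x).
  by have := is_derive_flat 0 x; rewrite mul0r subr0.
have mulE (c x : R) (h : R -> R) (dh : R) : is_derive x (1 : R) h dh ->
    is_derive x (1 : R) (fun y => c * h y) (c * dh).
  by move=> H; exact: (@is_deriveZ _ _ _ _ c).
have subE (x : R) (h : R -> R) (dh : R) : is_derive x (1 : R) h dh ->
    is_derive x (1 : R) (fun y => 1 - h y) (- dh).
  move=> H; rewrite -sub0r; exact: (@is_deriveB R R R (cst 1) h x 1 0 dh (is_derive_cst _ _ _) H).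
rewrite stepE derive1E.
pose inner x : R := 1 - expR 1 * flat 0 (1 - x).
have dinner : is_derive s (1 : R) inner (- (expR 1 * (flat 2 (1 - s) * - 1))).
  by apply: subE; apply: mulE; apply: (@is_derive_compR R R _ (fun y => 1 - y)) => //.
have H := mulE (expR 1) s _ _ (@is_derive_compR R R _ inner _ _ _ _ (dflat (inner s)) dinner).
case: H => _ ->.
by rewrite mulrN1 [X in - X]mulrN opprK !mulr_ge0 ?expR_ge0 ?flat_ge0.
Qed.

Definition plateau s : R := step (2 - s) * step (2 + s).

Lemma smooth_plateau : smooth plateau.
Proof.
move=> k; apply: CkM; apply: (@Ck_comp R R k (@step R) _ (@smooth_step k)).
  rewrite (_ : (fun x => _) = fun s => 2 + (- 1) * s).
    by apply: CkD; [exact: Ck_cst|apply: CkM; [exact: Ck_cst|exact: Ck_id]].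
  by apply/funext => s; rewrite mulN1r.
by apply: CkD; [exact: Ck_cst|exact: Ck_id].
Qed.

Lemma plateau_eq1 s : `|s| <= 1 -> plateau s = 1.
Proof.
rewrite ler_norml => /andP[s1 s2].
by rewrite /plateau !step_ge1 ?mul1r//; lra.
Qed.

Lemma plateau_eq0 s : 2 <= `|s| -> plateau s = 0.
Proof.
rewrite ler_normr => /orP[] s2; rewrite /plateau.
  by rewrite (step_le0 (s := 2 - s)) ?mul0r//; lra.
by rewrite (step_le0 (s := 2 + s)) ?mulr0//; lra.
Qed.

Lemma plateau_ge0 s : 0 <= plateau s.
Proof. by rewrite mulr_ge0// step_ge0. Qed.

Lemma plateau_le1 s : plateau s <= 1.
Proof. by rewrite mulr_ile1// ?step_ge0// step_le1. Qed.

End Step.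

(** * Powers of the plateau and the size of their derivatives *)

Section Cutoff.
Variable R : realType.
Implicit Types (s : R) (m : nat).

Lemma is_deriveXn (f : R -> R) (x df : R) k : is_derive x (1 : R) f df ->
  is_derive x (1 : R) (fun y => f y ^+ k) (k%:R * f x ^+ k.-1 * df).
Proof.
by move=> fdf; have := @is_deriveX R R f k x 1 df fdf; rewrite exprfctE.
Qed.

Lemma derive1_near_cst (f : R -> R) (c x : R) :
  (\forall y \near x, f y = c) -> f^`()%classic x = 0.
Proof.
move=> fc; rewrite derive1E.
rewrite -(@near_eq_derive R R R (cst c) f); last by near=> y; rewrite (near fc y).
exact: derive_cst.
Unshelve. all: by end_near. Qed.

Lemma bounded_supp (f : R -> R) (r : R) : 0 <= r -> continuous f ->
  (forall s, r < `|s| -> f s = 0) -> exists2 M, 0 <= M & forall s, `|f s| <= M.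
Proof.
move=> r0 cf f0.
have cnf : {within `[- r, r], continuous (fun s => `|f s|)}.
  apply: continuous_subspaceT => x.
  by apply: continuous_comp; [exact: cf|exact: norm_continuous].
have [|c _ fle] := @EVT_max _ _ (- r) r _ cnf; first by lra.
exists `|f c| => // s; have [sr|sr] := leP `|s| r; last by rewrite f0// normr0.
by apply: fle; rewrite in_itv/= -ler_norml.
Qed.

Local Notation plateau := (@plateau R).

Lemma near_plateau_eq1 s : `|s| < 1 -> \forall y \near s, plateau y = 1.
Proof.
move=> s1; have : \forall y \near s, `|y| < 1.
  exact: (cvgr_lt `|s| (@norm_continuous R R s)).
by apply: filterS => y y1; rewrite plateau_eq1// ltW.
Qed.

Lemma near_plateau_eq0 s : 2 < `|s| -> \forall y \near s, plateau y = 0.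
Proof.
move=> s1; have : \forall y \near s, 2 < `|y|.
  exact: (cvgr_gt `|s| (@norm_continuous R R s)).
by apply: filterS => y y1; rewrite plateau_eq0// ltW.
Qed.

Lemma near_derive1 (f : R -> R) (c x : R) :
  (\forall y \near x, f y = c) -> \forall y \near x, f^`()%classic y = 0.
Proof.
move=> /near_join; apply: filterS => y; exact: derive1_near_cst.
Qed.

Lemma plateau_derive_bounded : exists2 M, 0 <= M &
  forall s, `|plateau^`()%classic s| <= M /\ `|plateau^`()%classic^`()%classic s| <= M.
Proof.
have s1 := smooth_derive1 (@smooth_plateau R).
have s2 := smooth_derive1 s1.
have [||M1 M10 H1] := @bounded_supp (plateau^`()%classic) 2 (ler0n _ _).
- exact: (s1 0%N).
- by move=> s s2'; apply: derive1_near_cst (near_plateau_eq0 s2').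
have [||M2 M20 H2] := @bounded_supp (plateau^`()%classic^`()%classic) 2 (ler0n _ _).
- exact: (s2 0%N).
- move=> s s2'; apply: derive1_near_cst; apply: near_derive1 (near_plateau_eq0 s2').
exists (M1 + M2); first exact: addr_ge0.
by move=> s; split; [rewrite ler_wpDr|rewrite ler_wpDl].
Qed.

(** Two derivatives of [plateau ^ (m + 2)] still leave the factor
    [plateau ^ m]; this is what lets the derivatives be absorbed by the cutoff
    itself. *)
Definition cutoff m s : R := plateau s ^+ m.+2.

Lemma smooth_cutoff m : smooth (cutoff m).
Proof.
move=> k; rewrite (_ : cutoff m = fun s => \prod_(i < m.+2) plateau s).
  by apply: Ck_prod => i; exact: smooth_plateau.
by apply/funext => s; rewrite prodr_const card_ord.
Qed.

Lemma cutoff_derive1 m : (cutoff m)^`()%classic =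
  (fun s => m.+2%:R * plateau s ^+ m.+1 * plateau^`()%classic s).
Proof.
apply/funext => s; rewrite derive1E.
by have [] := is_deriveXn m.+2 (smooth_is_derive (@smooth_plateau R) s).
Qed.

Lemma cutoff_derive2 m s : (cutoff m)^`()%classic^`()%classic s =
  m.+2%:R * (m.+1%:R * plateau s ^+ m * plateau^`()%classic s ^+ 2 +
             plateau s ^+ m.+1 * plateau^`()%classic^`()%classic s).
Proof.
rewrite cutoff_derive1 derive1E.
have sb := @smooth_plateau R.
have d1 := smooth_is_derive (smooth_derive1 sb) s.
have dX := is_deriveXn m.+1 (smooth_is_derive sb s).
have dM := @is_deriveM R R _ _ _ _ _ _ dX d1.
have dZ : is_derive s (1 : R)
    (fun y => m.+2%:R * (plateau y ^+ m.+1 * plateau^`()%classic y))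
    (m.+2%:R * (plateau s ^+ m.+1 * plateau^`()%classic^`()%classic s +
      plateau^`()%classic s * (m.+1%:R * plateau s ^+ m * plateau^`()%classic s))).
  exact: (@is_deriveZ R R R _ m.+2%:R _ _ _ dM).
rewrite (_ : (fun s => _ * _ * _) =
    fun y => m.+2%:R * (plateau y ^+ m.+1 * plateau^`()%classic y)).
  by case: dZ => _ ->; ring.
by apply/funext => y; rewrite -mulrA.
Qed.

Lemma cutoff_derive_le m : exists2 C, 0 <= C & forall s,
  `|(cutoff m)^`()%classic s| <= C * plateau s ^+ m /\
  `|(cutoff m)^`()%classic^`()%classic s| <= C * plateau s ^+ m.
Proof.
have [M M0 HM] := plateau_derive_bounded.
pose C := m.+2%:R * (m.+1%:R * M ^+ 2 + M).
exists C; first by rewrite mulr_ge0// addr_ge0// mulr_ge0// exprn_ge0.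
move=> s; have [b1 b2] := HM s; have b0 := plateau_ge0 s; have b01 := plateau_le1 s.
have bm : 0 <= plateau s ^+ m by rewrite exprn_ge0.
have bS : plateau s ^+ m.+1 <= plateau s ^+ m by rewrite exprS ler_piMl.
split.
  rewrite cutoff_derive1 normrM normrM normr_nat [`|_ ^+ _|]ger0_norm ?exprn_ge0//.
  rewrite -!mulrA ler_wpM2l// mulrC; apply: ler_pM => //; first exact: exprn_ge0.
  by rewrite (le_trans b1)// lerDr mulr_ge0// exprn_ge0.
rewrite cutoff_derive2 normrM normr_nat -!mulrA ler_wpM2l// mulrDl.
rewrite (le_trans (ler_normD _ _))// lerD//.
  rewrite normrM normr_nat -mulrA ler_wpM2l// normrM.
  rewrite [`|_ ^+ m|]ger0_norm// mulrC ler_wpM2r// normrX.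
  by rewrite lerXn2r ?nnegrE.
rewrite normrM ger0_norm ?exprn_ge0// mulrC ler_pM// exprn_ge0//.
Qed.

Lemma cutoff_derive1_eq0 m s : `|s| < 1 -> (cutoff m)^`()%classic s = 0.
Proof.
move=> s1; rewrite cutoff_derive1 (derive1_near_cst (near_plateau_eq1 s1)).
by rewrite mulr0.
Qed.

Lemma cutoff_derive2_eq0 m s : `|s| < 1 -> (cutoff m)^`()%classic^`()%classic s = 0.
Proof.
move=> s1; rewrite cutoff_derive2 (derive1_near_cst (near_plateau_eq1 s1)).
rewrite (derive1_near_cst (near_derive1 (near_plateau_eq1 s1))).
by rewrite expr0n !mulr0 addr0 mulr0.
Qed.

End Cutoff.

(** * Pairings of curves in L^2 *)

Section PowerBounds.
Variable R : realType.
Implicit Types (a b p q : R).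

Lemma powR_le1D a q : 0 <= a -> 0 <= q -> q <= 1 -> a `^ q <= 1 + a.
Proof.
move=> a0 q0 q1; have [a1|a1] := leP a 1.
  apply: (@le_trans _ _ 1); last by rewrite lerDl.
  have <- : 1 `^ q = 1 :> R by rewrite powR1.
  by rewrite ge0_ler_powR// nnegrE.
rewrite -[X in 1 + X](powRr1 a0) ler_wpDl//.
by rewrite ler_powR// ltW.
Qed.

Lemma powR_le1Dsqr a p : 0 <= a -> 0 <= p -> p <= 2 -> a `^ p <= 1 + a ^+ 2.
Proof.
move=> a0 p0 p2; have [a1|a1] := leP a 1.
  apply: (@le_trans _ _ 1); last by rewrite lerDl sqr_ge0.
  have <- : 1 `^ p = 1 :> R by rewrite powR1.
  by rewrite ge0_ler_powR// nnegrE.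
by rewrite -powR_mulrn// ler_wpDl// ler_powR// ltW.
Qed.

(** Writing [b ^ p = b * b ^ (p - 1)], the difference splits into
    [b ^ (p - 1) * (b - a)] and a cross term that is controlled since
    [a * b ^ (p - 1) <= b * a ^ (p - 1)] when [a <= b] and [p - 1 <= 1]. *)
Lemma powR_dist_le a b p : 0 <= a -> 0 <= b -> 1 <= p -> p <= 2 ->
  `|a `^ p - b `^ p| <= 2 * `|a - b| * (1 + a + b).
Proof.
wlog ab : a b / a <= b => [H a0 b0 p1 p2|a0 b0 p1 p2].
  have [ab|ab] := leP a b; first exact: H.
  by rewrite distrC (distrC a) addrAC; apply: H => //; exact: ltW.
have p0 : p != 0 by rewrite gt_eqF// (lt_le_trans _ p1).
have pE : p = 1 + (p - 1) by rewrite addrC subrK.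
have powE c : 0 <= c -> c `^ p = c * c `^ (p - 1).
  move=> c0; rewrite {1}pE (@powRD _ c 1) ?powRr1//.
  by rewrite -pE (negbTE p0).
have q0 : 0 <= p - 1 by lra.
have q1 : p - 1 <= 1 by lra.
have abp : a `^ p <= b `^ p by rewrite ge0_ler_powR// ?nnegrE//; lra.
rewrite distrC ger0_norm ?subr_ge0// distrC ger0_norm ?subr_ge0//.
have cross : a * b `^ (p - 1) <= b * a `^ (p - 1).
  have [->|an0] := eqVneq a 0; first by rewrite mul0r mulr_ge0// powR_ge0.
  have agt0 : 0 < a by rewrite lt_neqAle eq_sym an0.
  have -> : b `^ (p - 1) = (b / a) `^ (p - 1) * a `^ (p - 1).
    by rewrite -powRM// ?divfK// divr_ge0.
  rewrite mulrA ler_wpM2r ?powR_ge0//.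
  rewrite mulrC -ler_pdivlMr// -[leRHS]powRr1 ?divr_ge0//.
  by rewrite ler_powR// ler_pdivlMr// mul1r.
rewrite !powE//.
have h1 := powR_le1D b0 q0 q1; have h2 := powR_le1D a0 q0 q1.
have := powR_ge0 a (p - 1); have := powR_ge0 b (p - 1).
move: cross h1 h2; move: (a `^ _) (b `^ _) => A B cross h1 h2 B0 A0.
nra.
Qed.

End PowerBounds.

Section L2pairing.
Context d (T : measurableType d) (R : realType).
Variable mu : {measure set T -> \bar R}.
Implicit Types f g w b : T -> R.
Local Notation L2 := (Lfun mu 2%:E).

Definition l2norm f : R := fine ('N[mu]_2%:E[EFin \o f])%E.

Lemma Lfun2_measurable f : f \in L2 -> measurable_fun setT f.
Proof. by rewrite inE => /andP[]; rewrite inE. Qed.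

Lemma Lfun2_finite f : f \in L2 -> ('N[mu]_2%:E[EFin \o f] = (l2norm f)%:E)%E.
Proof.
rewrite inE => /andP[_]; rewrite inE => /= ff.
by rewrite /l2norm fineK// ge0_fin_numE ?Lnorm_ge0.
Qed.

Lemma Lfun2D f g : f \in L2 -> g \in L2 -> (fun x => f x + g x) \in L2.
Proof.
move=> fL gL; have p1 : (1 <= 2%:E :> \bar R)%E by rewrite lee_fin ler1n.
by have [_ ] := Lfun_addr_closed mu p1; exact.
Qed.

Lemma Lfun2Z f (a : R) : f \in L2 -> (fun x => a * f x) \in L2.
Proof.
by move=> fL; under eq_fun do rewrite mulrC; apply: Lfun_scale => //; rewrite ler1n.
Qed.

Lemma Lfun2B f g : f \in L2 -> g \in L2 -> (fun x => f x - g x) \in L2.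
Proof.
move=> fL gL; rewrite (_ : (fun x => _) = fun x => f x + (-1) * g x).
  by apply: Lfun2D => //; exact: Lfun2Z.
by apply/funext => x; rewrite mulN1r.
Qed.

Lemma Lfun2_normr f : f \in L2 -> (fun x => `|f x|) \in L2.
Proof.
move=> fL; rewrite inE; apply/andP; split; rewrite inE/=.
  by apply: measurableT_comp => //; exact: Lfun2_measurable.
rewrite /finite_norm.
rewrite (_ : EFin \o _ = abse \o (EFin \o f)) ?Lnorm_abse//.
by move: fL; rewrite inE => /andP[_]; rewrite inE.
Qed.

Lemma Lfun2M_integrable f g : f \in L2 -> g \in L2 ->
  mu.-integrable setT (EFin \o (fun x => f x * g x)).
Proof. by move=> fL gL; apply/Lfun1_integrable; exact: Lfun2_mul_Lfun1. Qed.

Lemma cauchy_schwarz f g : f \in L2 -> g \in L2 ->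
  \int[mu]_x `|f x * g x| <= l2norm f * l2norm g.
Proof.
move=> fL gL; rewrite -lee_fin EFinM -!Lfun2_finite//.
have H : ('N[mu]_1%:E[EFin \o (f \* g)%R] <=
    'N[mu]_2%:E[EFin \o f] * 'N[mu]_2%:E[EFin \o g])%E.
  apply: hoelder => //; try exact: Lfun2_measurable.
  by rewrite [RHS]splitr !div1r.
apply: le_trans H; rewrite Lnorm1 /Rintegral fineK//.
have := integrable_abse (Lfun2M_integrable fL gL).
by move=> /integrable_fin_num; apply.
Qed.

Lemma cauchy_schwarz_norm f g : f \in L2 -> g \in L2 ->
  `|\int[mu]_x (f x * g x)| <= l2norm f * l2norm g.
Proof.
move=> fL gL; apply: le_trans (cauchy_schwarz fL gL).
by apply: le_normr_Rintegral => //; exact: Lfun2M_integrable.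
Qed.

Section limits.
Context (S : Type) (F : set_system S) {FF : Filter F}.
Implicit Type U : S -> T -> R.

Lemma pairing_cvg U w b : (\forall s \near F, U s \in L2) -> w \in L2 -> b \in L2 ->
  l2norm (fun x => U s x - w x) @[s --> F] --> 0 ->
  \int[mu]_x (U s x * b x) @[s --> F] --> \int[mu]_x (w x * b x).
Proof.
move=> UL wL bL U0; apply/cvgrPdistC_le => e e0 /=.
have : (l2norm (fun x => U s x - w x) * l2norm b) @[s --> F] --> 0.
  by rewrite -[X in _ --> X](mul0r (l2norm b)); apply: cvgMl.
move=> /cvgr0Pnorm_le /(_ _ e0); apply: filterS2 UL => s UsL.
apply: le_trans; rewrite -RintegralB//; try exact: Lfun2M_integrable.
under eq_Rintegral do rewrite -mulrBl.
rewrite (le_trans (cauchy_schwarz_norm (Lfun2B UsL wL) bL))//.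
exact: ler_norm.
Qed.

(** The cutoff [b] makes up for the infinite measure of the space: it dominates
    the part where [|w| <= 1], and [w ^ 2] the rest. *)
Lemma powR_integrable w b p : w \in L2 -> b \in L2 ->
  mu.-integrable setT (EFin \o b) -> (forall x, 0 <= b x <= 1) ->
  0 <= p -> p <= 2 -> mu.-integrable setT (EFin \o (fun x => `|w x| `^ p * b x)).
Proof.
move=> wL bL bI b01 p0 p2.
apply: (@le_integrable _ _ _ mu setT measurableT _
  (EFin \o (fun x => b x + w x ^+ 2))).
- apply/measurable_EFinP; apply: measurable_funM; last exact: Lfun2_measurable.
  apply: (measurableT_comp (measurable_powR p)).
  by apply: measurableT_comp => //; exact: Lfun2_measurable.
- move=> x _ /=; have /andP[b0 b1] := b01 x.
  rewrite lee_fin (@ger0_norm _ (`|w x| `^ p * b x)) ?mulr_ge0 ?powR_ge0//.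
  rewrite (@ger0_norm _ (b x + _)) ?addr_ge0 ?sqr_ge0//.
  have H := powR_le1Dsqr (normr_ge0 (w x)) p0 p2.
  rewrite real_normK ?num_real// in H.
  apply: (@le_trans _ _ ((1 + w x ^+ 2) * b x)); first exact: ler_wpM2r.
  by rewrite mulrDl mul1r lerD2l ler_piMr ?sqr_ge0.
- exact: (integrableD measurableT bI (Lfun2_integrable_sqr wL)).
Qed.

(** With [D = U s - w], [powR_dist_le] bounds the difference of the integrands by
    [2 |D| (b + 2 |w|) + 2 |D|^2], and [b + 2 |w|] is a fixed square-integrable
    function; conclude by Cauchy-Schwarz. *)
Lemma powR_cvg U w b p : (\forall s \near F, U s \in L2) -> w \in L2 -> b \in L2 ->
  mu.-integrable setT (EFin \o b) -> (forall x, 0 <= b x <= 1) ->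
  1 <= p -> p <= 2 -> l2norm (fun x => U s x - w x) @[s --> F] --> 0 ->
  \int[mu]_x (`|U s x| `^ p * b x) @[s --> F] --> \int[mu]_x (`|w x| `^ p * b x).
Proof.
move=> UL wL bL bI b01 p1 p2 U0; apply/cvgrPdistC_le => e e0 /=.
have p0 : 0 <= p by lra.
pose c x := b x + 2 * `|w x|.
have cL : c \in L2 by apply: Lfun2D => //; apply: Lfun2Z; exact: Lfun2_normr.
have : (2 * (l2norm (fun x => U s x - w x) * l2norm c) +
  2 * (l2norm (fun x => U s x - w x) * l2norm (fun x => U s x - w x)))
     @[s --> F] --> 0.
  rewrite (_ : 0 = 2 * (0 * l2norm c) + 2 * (0 * 0)); last by rewrite !mul0r !mulr0 addr0.
  apply: cvgD; apply: cvgMr; first exact: cvgMl.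
  exact: cvgM.
move=> /cvgr0Pnorm_le /(_ _ e0); apply: filterS2 UL => s UsL.
apply: le_trans; rewrite -RintegralB//; try exact: powR_integrable.
pose D x := U s x - w x.
have DL : D \in L2 by exact: Lfun2B.
have absI f g : f \in L2 -> g \in L2 ->
    mu.-integrable setT (EFin \o (fun x => `|f x * g x|)).
  by move=> fL gL; exact: (integrable_abse (Lfun2M_integrable fL gL)).
have sumI : mu.-integrable setT
    (EFin \o (fun x => 2 * `|D x * c x| + 2 * `|D x * D x|)).
  exact: (integrableD measurableT (integrableZl measurableT 2 (absI _ _ DL cL))
    (integrableZl measurableT 2 (absI _ _ DL DL))).
have difI : mu.-integrable setT
    (EFin \o (fun x => `|U s x| `^ p * b x - `|w x| `^ p * b x)).
  exact: (integrableB measurableT (powR_integrable UsL bL bI b01 p0 p2)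
    (powR_integrable wL bL bI b01 p0 p2)).
rewrite (le_trans (le_normr_Rintegral _ difI))//.
apply: (@le_trans _ _ (\int[mu]_x (2 * `|D x * c x| + 2 * `|D x * D x|))).
  apply: le_Rintegral => //; first exact: (integrable_abse difI).
  move=> x _; rewrite -mulrBl normrM; have /andP[b0 b1] := b01 x.
  rewrite (ger0_norm b0).
  have := powR_dist_le (normr_ge0 (U s x)) (normr_ge0 (w x)) p1 p2.
  have hd : `| `|U s x| - `|w x| | <= `|D x| by exact: ler_dist_dist.
  have hu : `|U s x| <= `|D x| + `|w x|.
    by rewrite -{1}(subrK (w x) (U s x)); exact: ler_normD.
  rewrite !normrM (@ger0_norm _ (c x)) ?addr_ge0 ?mulr_ge0// /c.
  move: (normr_ge0 (U s x)) (normr_ge0 (w x)) (normr_ge0 (D x)) hd hu.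
  move: (normr_ge0 (`|U s x| - `|w x|)).
  move: (`| `|U s x| `^ p - `|w x| `^ p |) (`| `|U s x| - `|w x| |).
  move: (`|U s x|) (`|w x|) (`|D x|) => u v e' P d0 h1 h2 h3 h4 h5 h6 h7.
  apply: (@le_trans _ _ (2 * e' * (1 + (e' + v) + v) * b x)).
    rewrite ler_wpM2r//; apply: (le_trans h7); rewrite ler_pM//; last by lra.
    - by rewrite mulr_ge0.
    - by lra.
    - by lra.
  have : e' * (e' + 2 * v) * b x <= e' * (e' + 2 * v).
    by rewrite ler_piMr// mulr_ge0//; lra.
  lra.
rewrite RintegralD//; last 2 first.
- exact: (integrableZl measurableT 2 (absI _ _ DL cL)).
- exact: (integrableZl measurableT 2 (absI _ _ DL DL)).
rewrite !RintegralZl//; try exact: absI.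
by apply: le_trans (ler_norm _); rewrite lerD// ler_wpM2l// cauchy_schwarz//.
Qed.

End limits.
End L2pairing.

(** * Cutoffs on boxes of space and time *)

Section SpaceTime.
Variables (R : realType) (n : nat).
Local Notation mu := (lebesgue_rV R n).
Implicit Types (r t th y : R) (x : 'rV[R]_n).
Local Notation c := (@cutoff R n).
Local Notation c1 := (c^`()%classic).
Local Notation c2 := (c^`()%classic^`()%classic).

(** Parabolic scaling: time is measured in units of [r ^ 2], space in units of
    [r].  The product over the coordinates replaces a radial cutoff, so that only
    functions of one real variable have to be smoothed. *)
Definition time_cut r t : R := c (t / r ^+ 2).
Definition space_cut r x : R := \prod_i c (x 0 i / r).
(** The derivatives of [space_cut] along the axes have this shape. *)
Definition space_rep r (g : R -> R) i x : R :=
  \prod_j (if j == i then g else c) (x 0 j / r).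
Definition space_lap r x : R := \sum_i r ^- 2 * space_rep r c2 i x.

Definition box r : set 'rV[R]_n := [set x | forall i, `|x 0 i| <= 2 * r].

Lemma cutoff_ge0 m (s : R) : 0 <= cutoff m s.
Proof. by rewrite exprn_ge0// plateau_ge0. Qed.

Lemma cutoff_le1 m (s : R) : cutoff m s <= 1.
Proof. by rewrite exprn_ile1 ?plateau_ge0 ?plateau_le1. Qed.

Lemma cutoff_eq1 m (s : R) : `|s| <= 1 -> cutoff m s = 1.
Proof. by move=> s1; rewrite /cutoff plateau_eq1// expr1n. Qed.

Lemma cutoff_eq0 m (s : R) : 2 <= `|s| -> cutoff m s = 0.
Proof. by move=> s1; rewrite /cutoff plateau_eq0// expr0n. Qed.

Lemma space_cut_ge0 r x : 0 <= space_cut r x.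
Proof. by apply: prodr_ge0 => i _; exact: cutoff_ge0. Qed.

Lemma space_cut_le1 r x : space_cut r x <= 1.
Proof. by apply: prodr_ile1 => i; rewrite cutoff_ge0 cutoff_le1. Qed.

Lemma normr_scale_le (s r M : R) : 0 < r -> (`|s / r| <= M) = (`|s| <= M * r).
Proof. by move=> r0; rewrite normrM normfV (gtr0_norm r0) ler_pdivrMr. Qed.

Lemma normr_scale_ge (s r M : R) : 0 < r -> (M <= `|s / r|) = (M * r <= `|s|).
Proof. by move=> r0; rewrite normrM normfV (gtr0_norm r0) ler_pdivlMr. Qed.

Lemma space_cut_box r x : 0 < r -> ~ box r x -> space_cut r x = 0.
Proof.
move=> r0 /existsNP[i /negP]; rewrite -ltNge => xi.
rewrite /space_cut (bigD1 i)//= cutoff_eq0 ?mul0r//.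
by rewrite normr_scale_ge// ltW.
Qed.

Lemma space_cut_eq1 r x : 0 < r -> (forall i, `|x 0 i| <= r) -> space_cut r x = 1.
Proof.
move=> r0 xr; rewrite /space_cut big1// => i _.
by rewrite cutoff_eq1// normr_scale_le// mul1r.
Qed.

(** The smaller cutoff is supported where the larger one equals 1. *)
Lemma space_cut_mono r r' x : 0 < r -> 2 * r <= r' -> space_cut r x <= space_cut r' x.
Proof.
move=> r0 rr'; have [bx|nbx] := pselect (box r x); last first.
  by rewrite space_cut_box// space_cut_ge0.
rewrite (@space_cut_eq1 r'); first exact: space_cut_le1.
  by apply: lt_le_trans rr'; rewrite mulr_gt0.
by move=> i; exact: le_trans (bx i) rr'.
Qed.

Lemma time_cut_mono r r' t : 0 < r -> 2 * r <= r' -> time_cut r t <= time_cut r' t.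
Proof.
move=> r0 rr'; have r'0 : 0 < r' by lra.
have [tr|tr] := leP (2 * r ^+ 2) `|t|.
  by rewrite /time_cut cutoff_eq0 ?cutoff_ge0// normr_scale_ge// exprn_gt0.
rewrite [leRHS]cutoff_eq1 ?cutoff_le1// normr_scale_le ?exprn_gt0// mul1r.
by apply: (le_trans (ltW tr)); nra.
Qed.

Lemma measurable_coordR (i : 'I_n) : measurable_fun setT (fun x : 'rV[R]_n => x 0 i).
Proof. exact: measurable_coord. Qed.

Lemma measurable_coord_comp (g : R -> R) (i : 'I_n) r : continuous g ->
  measurable_fun setT (fun x : 'rV[R]_n => g (x 0 i / r)).
Proof.
move=> cg; apply: (measurableT_comp (continuous_measurable_fun cg)).
by apply: measurable_funM => //; exact: measurable_coordR.
Qed.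

Lemma continuous_cutoff : continuous c.
Proof. exact: (@smooth_cutoff R n 0%N). Qed.

Lemma measurable_space_cut r : measurable_fun setT (space_cut r).
Proof.
apply: measurable_prod => i _; apply: measurable_coord_comp.
exact: continuous_cutoff.
Qed.

Lemma box_measure r : 0 < r -> mu (box r) = ((4 * r) ^+ n)%:E.
Proof.
move=> r0.
rewrite (_ : box r = [set v | forall i, [set` `[- (2 * r), 2 * r]] (v 0 i)]).
  have /= -> := @lebesgue_rV_box R n (fun=> [set` `[- (2 * r), 2 * r]])
    (fun=> measurable_itv _).
  rewrite (eq_bigr (fun=> (4 * r)%:E)); last first.
    move=> i _; rewrite lebesgue_measure_itv/= lte_fin; case: ifPn.
      by move=> _; rewrite -EFinB; congr EFin; lra.
    by move=> /negP; case; lra.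
  by rewrite prodEFin prodr_const card_ord.
by apply/seteqP; split => x bx i; have := bx i; rewrite /= in_itv/= ler_norml.
Qed.

Lemma measurable_box r : measurable (box r).
Proof.
rewrite (_ : box r = \bigcap_(i in [set: 'I_n]) (@Defs.coord R n i @^-1` `[- (2 * r), 2 * r])).
  apply: fin_bigcap_measurable => // i _; rewrite -[X in measurable X]setTI.
  exact: measurable_coord.
apply/seteqP; split => [x bx i _|x bx i]; have := bx i.
  by rewrite /= in_itv/= ler_norml.
by rewrite /= in_itv/= ler_norml; exact.
Qed.

Lemma measurable_space_rep r g i : continuous g ->
  measurable_fun setT (space_rep r g i).
Proof.
move=> cg; apply: measurable_prod => j _; apply: measurable_coord_comp.
by case: ifP => // _; exact: continuous_cutoff.
Qed.

Lemma measurable_space_lap r : measurable_fun setT (space_lap r).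
Proof.
apply: measurable_sum => i; apply: measurable_funM => //.
apply: measurable_space_rep.
exact: (smooth_derive1 (smooth_derive1 (@smooth_cutoff R n)) 0%N).
Qed.

Lemma box_indic_integrable r : 0 < r -> mu.-integrable setT (EFin \o \1_(box r)).
Proof.
move=> r0; have mB := measurable_box r.
  apply/integrableP; split; first exact/measurable_EFinP.
rewrite (eq_integral (fun x => (\1_(box r) x)%:E)); last first.
  by move=> t _; rewrite /= ger0_norm.
rewrite integral_indic// setIT; apply: (@le_lt_trans _ _ (mu (box r))) => //.
by rewrite box_measure// ltry.
Qed.

(** Cutoffs and their Laplacians are tested against functions that are merely
    square-integrable, hence the need for both conclusions. *)
Lemma box_bounded_L2 r M (g : 'rV[R]_n -> R) : 0 < r -> measurable_fun setT g ->
  (forall x, `|g x| <= M * \1_(box r) x) ->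
  g \in Lfun mu 2%:E /\ mu.-integrable setT (EFin \o g).
Proof.
move=> r0 mg gM.
have I1 := box_indic_integrable r0.
have IM N : mu.-integrable setT (EFin \o (fun x => N * \1_(box r) x)).
  exact: (integrableZl measurableT N I1).
split; last first.
  apply: (le_integrable measurableT _ _ (IM M)); first exact/measurable_EFinP.
  by move=> x _ /=; rewrite lee_fin (le_trans (gM x))// ler_norm.
rewrite inE; apply/andP; split; rewrite inE//=.
rewrite /finite_norm unlock /Lnorm poweR_lty//.
have : mu.-integrable setT (EFin \o (fun x => `|g x| `^ 2)).
  apply: (le_integrable measurableT _ _ (IM (M ^+ 2))).
    apply/measurable_EFinP; apply: (measurableT_comp (measurable_powR 2)).
    exact: measurableT_comp.
  move=> x _ /=; rewrite lee_fin powR_mulrn// normrX normr_id.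
  apply: (@le_trans _ _ ((M * \1_(box r) x) ^+ 2)).
    by rewrite lerXn2r ?nnegrE// (le_trans _ (gM x)).
  by rewrite indicE; case: (_ \in _); rewrite ?mulr1 ?mulr0 ?expr0n ?ler_norm.
move=> /integrableP[_]; apply: le_lt_trans; rewrite le_eqVlt; apply/orP; left.
apply/eqP; apply: eq_integral => x _ /=.
by rewrite [in RHS]ger0_norm ?powR_ge0.
Qed.

End SpaceTime.

(** * The adjoint operator on the cutoff *)

Section Pointwise.
Variables (R : realType) (n : nat).
Local Notation mu := (lebesgue_rV R n).
Implicit Types (r t th y : R) (x : 'rV[R]_n).
Local Notation c := (@cutoff R n).
Local Notation c1 := (c^`()%classic).
Local Notation c2 := (c^`()%classic^`()%classic).

Local Notation time_cut := (@time_cut R n).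

Definition space_plateau r x : R := \prod_i plateau (x 0 i / r).

Lemma space_plateau_ge0 r x : 0 <= space_plateau r x.
Proof. by apply: prodr_ge0 => i _; exact: plateau_ge0. Qed.

Lemma space_plateau_le1 r x : space_plateau r x <= 1.
Proof. by apply: prodr_ile1 => i; rewrite plateau_ge0 plateau_le1. Qed.

Lemma space_cutE r x : space_cut r x = space_plateau r x ^+ n.+2.
Proof. by rewrite /space_cut /space_plateau prodrXl. Qed.

Lemma space_plateau_box r x : 0 < r -> ~ box r x -> space_plateau r x = 0.
Proof.
move=> r0 /existsNP[i /negP]; rewrite -ltNge => xi.
rewrite /space_plateau (bigD1 i)//= plateau_eq0 ?mul0r//.
by rewrite normr_scale_ge// ltW.
Qed.

Lemma exprSS_le (a : R) : 0 <= a -> a <= 1 -> a ^+ n.+2 <= a ^+ n.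
Proof.
by move=> a0 a1; rewrite -addn2 exprD ler_piMr ?exprn_ge0// exprn_ile1.
Qed.

Lemma space_rep_le (C : R) r i x : 0 <= C -> (forall s, `|c2 s| <= C * plateau s ^+ n) ->
  `|space_rep r c2 i x| <= C * space_plateau r x ^+ n.
Proof.
move=> C0 Hc; rewrite /space_rep normr_prod /space_plateau -prodrXl.
rewrite (bigD1 i)//= [in leRHS](bigD1 i)//= eqxx mulrA ler_pM//.
  by apply: prodr_ge0.
apply: ler_prod => j /negbTE ->; rewrite normr_ge0/= ger0_norm ?cutoff_ge0//.
by apply: exprSS_le; rewrite ?plateau_ge0 ?plateau_le1.
Qed.

Lemma space_rep_eq0 r i x : 0 < r -> (forall j, `|x 0 j| < r) -> space_rep r c2 i x = 0.
Proof.
move=> r0 xr; rewrite /space_rep (bigD1 i)//= eqxx cutoff_derive2_eq0 ?mul0r//.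
by rewrite normrM normfV (gtr0_norm r0) ltr_pdivrMr// mul1r.
Qed.

(** The formal adjoint [psi_tt - Delta psi - psi_t] of the damped wave operator,
    applied to [psi r = time_cut r * space_cut r]. *)
Definition wave_op r t x : R :=
  (r ^- 4 * c2 (t / r ^+ 2) - r ^- 2 * c1 (t / r ^+ 2)) * space_cut r x
  - time_cut r t * space_lap r x.

(** Every derivative of a cutoff costs at most one power of [plateau] and gains
    [r^-1] in space and [r^-2] in time; second time derivatives are better since
    [1 <= r]. *)
Lemma wave_op_le : exists2 C, 0 < C & forall r t x, 1 <= r ->
  `|wave_op r t x| <= C / r ^+ 2 * (plateau (t / r ^+ 2) * space_plateau r x) ^+ n.
Proof.
have [C C0 HC] := @cutoff_derive_le R n.
have HC2 s : `|c2 s| <= C * plateau s ^+ n by case: (HC s).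
have HC1 s : `|c1 s| <= C * plateau s ^+ n by case: (HC s).
exists ((2 + n%:R) * C + 1); first by rewrite ltr_wpDl// mulr_ge0// addr_ge0.
move=> r t x r1; have r0 : 0 < r by rewrite (lt_le_trans ltr01).
rewrite /wave_op exprMn.
set q := plateau (t / r ^+ 2) ^+ n; set P := space_plateau r x ^+ n.
have q0 : 0 <= q by rewrite exprn_ge0// plateau_ge0.
have P0 : 0 <= P by rewrite exprn_ge0// space_plateau_ge0.
have r2 : r ^- 4 <= r ^- 2.
  by rewrite lef_pV2 ?posrE ?exprn_gt0// ler_weXn2l.
have ri : 0 <= r ^- 2 by rewrite invr_ge0 exprn_ge0// ltW.
have ri4 : 0 <= r ^- 4 by rewrite invr_ge0 exprn_ge0// ltW.
have sc : `|space_cut r x| <= P.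
  rewrite ger0_norm ?space_cut_ge0// space_cutE exprSS_le ?space_plateau_ge0 ?space_plateau_le1//.
have tc : `|time_cut r t| <= q.
  by rewrite ger0_norm ?cutoff_ge0// exprSS_le ?plateau_ge0 ?plateau_le1.
have lap : `|space_lap r x| <= r ^- 2 * (n%:R * C * P).
  rewrite /space_lap -mulr_sumr normrM ger0_norm// ler_wpM2l//.
  rewrite (le_trans (ler_norm_sum _ _ _))//.
  rewrite -[n in n%:R]card_ord -mulrA mulr_natl -sumr_const ler_sum// => i _.
  exact: space_rep_le.
have time : `|r ^- 4 * c2 (t / r ^+ 2) - r ^- 2 * c1 (t / r ^+ 2)| <= r ^- 2 * (2 * C * q).
  rewrite (le_trans (ler_normB _ _))// !normrM !(ger0_norm ri) !(ger0_norm ri4).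
  apply: (@le_trans _ _ (r ^- 2 * (C * q) + r ^- 2 * (C * q))); last by lra.
  apply: lerD; last by rewrite ler_wpM2l//; exact: HC1.
  by apply: ler_pM => //; exact: HC2.
rewrite (le_trans (ler_normB _ _))// normrM [`|time_cut r t * _|]normrM.
apply: (@le_trans _ _ (r ^- 2 * (2 * C * q) * P + q * (r ^- 2 * (n%:R * C * P)))).
  by rewrite lerD// ler_pM.
have : 0 <= r ^- 2 * (q * P) by rewrite !mulr_ge0.
lra.
Qed.

Lemma wave_op_eq0 r t x : 0 < r -> `|t| < r ^+ 2 -> (forall j, `|x 0 j| < r) ->
  wave_op r t x = 0.
Proof.
move=> r0 tr xr; have tr1 : `|t / r ^+ 2| < 1.
  by rewrite normrM normfV (gtr0_norm (exprn_gt0 _ r0)) ltr_pdivrMr ?exprn_gt0// mul1r.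
rewrite /wave_op cutoff_derive2_eq0// cutoff_derive1_eq0// !mulr0 subr0 mul0r.
by rewrite /space_lap big1 ?mulr0 ?subr0// => i _; rewrite space_rep_eq0 ?mulr0.
Qed.

Definition psi r t x : R := time_cut r t * space_cut r x.

Lemma psi_mono r t x : 0 < r -> psi (r / 2) t x <= psi r t x.
Proof.
move=> r0; have r20 : 0 < r / 2 by rewrite divr_gt0.
by apply: ler_pM; rewrite ?cutoff_ge0 ?space_cut_ge0//;
  [apply: time_cut_mono|apply: space_cut_mono] => //; lra.
Qed.

(** Together with [wave_op_eq0]: wherever the operator does not vanish,
    [psi r - psi (r / 2)] is the whole of [psi r]. *)
Lemma psi_half_eq0 r t x : 0 < r -> r ^+ 2 <= `|t| \/ (exists j, r <= `|x 0 j|) ->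
  psi (r / 2) t x = 0.
Proof.
move=> r0; have r20 : 0 < r / 2 by rewrite divr_gt0.
case=> [tr|[j xj]]; rewrite /psi.
  rewrite /time_cut cutoff_eq0 ?mul0r// normr_scale_ge ?exprn_gt0//.
  by apply: le_trans tr; nra.
rewrite /space_cut (bigD1 j)//= cutoff_eq0 ?mul0r ?mulr0//.
by rewrite normr_scale_ge// mulrC divfK.
Qed.

(** If the second term does not already dominate [y], then
    [1 <= th * y ^ (2 / n)] and the first one does. *)
Lemma young_critical y th : (0 < n)%N -> 0 <= y -> 0 < th ->
  y <= th * y `^ (1 + 2 / n%:R) + th `^ (- (n%:R / 2)).
Proof.
move=> n0 y0 th0; have [yth|yth] := leP y (th `^ (- (n%:R / 2))).
  by rewrite ler_wpDl// mulr_ge0 ?powR_ge0// ltW.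
have nR : 0 < n%:R :> R by rewrite ltr0n.
rewrite ler_wpDr ?powR_ge0//.
have ygt0 : 0 < y by apply: le_lt_trans yth; exact: powR_ge0.
rewrite powRD; last by rewrite (gt_eqF ygt0) implybT.
rewrite powRr1// mulrCA ler_peMr//.
have : th^-1 <= y `^ (2 / n%:R).
  have -> : th^-1 = (th `^ (- (n%:R / 2))) `^ (2 / n%:R).
    rewrite -powRrM (_ : _ * _ = -1) ?powR_inv1 ?(ltW th0)//.
    by field; rewrite gt_eqF.
  by rewrite ge0_ler_powR ?nnegrE ?powR_ge0 ?divr_ge0// ltW.
by rewrite -ler_pdivrMl ?mulr1.
Qed.

(** Isolated as a predicate because the constant must be chosen before the
    solution is given. *)
Definition young_constant (C : R) :=
  forall r t x y th, 1 <= r -> 0 <= y -> 0 < th ->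
  y * `|wave_op r t x| <= C / r ^+ 2 * (th * y `^ (1 + 2 / n%:R) *
     (psi r t x - psi (r / 2) t x) + th `^ (- (n%:R / 2)) * \1_(box r) x).

(** Young's inequality for [y * E ^ n], where [E] is the product of all plateaus;
    the critical exponent turns [(E ^ n) ^ (1 + 2 / n)] into [E ^ (n + 2)],
    that is [psi r]. *)
Lemma wave_op_young : (0 < n)%N -> exists2 C, 0 < C & young_constant C.
Proof.
move=> n0; have [C C0 HC] := wave_op_le; exists C => // r t x y th r1 y0 th0.
have r0 : 0 < r by rewrite (lt_le_trans ltr01).
have Cr : 0 <= C / r ^+ 2 by rewrite divr_ge0 ?ltW// exprn_gt0.
have rhs0 : 0 <= C / r ^+ 2 * (th * y `^ (1 + 2 / n%:R) *
     (psi r t x - psi (r / 2) t x) + th `^ (- (n%:R / 2)) * \1_(box r) x).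
  rewrite mulr_ge0// addr_ge0// mulr_ge0 ?powR_ge0//.
    by rewrite mulr_ge0 ?powR_ge0// ltW.
  by rewrite subr_ge0 psi_mono.
have [inner|outer] := pselect (`|t| < r ^+ 2 /\ forall j, `|x 0 j| < r).
  by case: inner => ? ?; rewrite wave_op_eq0 // normr0 mulr0.
(* On the shell where the operator lives, the smaller cutoff is gone. *)
have psi20 : psi (r / 2) t x = 0.
  apply: psi_half_eq0 => //; have [tr|tr] := leP (r ^+ 2) `|t|; first by left.
  right; apply: contrapT => /forallNP xj; apply: outer; split=> // j.
  by rewrite ltNge; apply/negP; exact: xj.
have [bx|nbx] := pselect (box r x); last first.
  apply: le_trans rhs0; have := HC r t x r1.
  rewrite (space_plateau_box r0 nbx) mulr0 expr0n eqn0Ngt n0 mulr0 normr_le0 => /eqP ->.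
  by rewrite normr0 mulr0.
rewrite psi20 subr0 indicE mem_set// mulr1.
apply: (@le_trans _ _ (y * (C / r ^+ 2 * (plateau (t / r ^+ 2) * space_plateau r x) ^+ n))).
  by rewrite ler_wpM2l// HC.
rewrite mulrCA ler_wpM2l//.
set E := plateau _ * space_plateau _ _.
have E0 : 0 <= E by rewrite mulr_ge0 ?plateau_ge0 ?space_plateau_ge0.
have -> : th * y `^ (1 + 2 / n%:R) * psi r t x = th * (y * E ^+ n) `^ (1 + 2 / n%:R).
  rewrite powRM ?exprn_ge0// -mulrA; congr (_ * (_ * _)).
  rewrite /psi space_cutE /time_cut /cutoff -exprMn -/E -[E ^+ n]powR_mulrn// -powRrM.
  rewrite -powR_mulrn//; congr (_ `^ _).
  by rewrite mulrDr mulr1 mulrCA divff ?mulr1 -?natrD ?addn2// pnatr_eq0 -lt0n.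
by apply: young_critical => //; rewrite mulr_ge0// exprn_ge0.
Qed.

End Pointwise.

(** * Test functions of product form *)

Section TestFunction.
Variables (R : realType) (n : nat).
Implicit Types (r t : R) (x : 'rV[R]_n).
Local Notation c := (@cutoff R n).
Local Notation c1 := (c^`()%classic).
Local Notation c2 := (c^`()%classic^`()%classic).
Local Notation V := (R * 'rV[R]_n)%type.

(** Directional derivatives of products of one-variable functions reduce to
    ordinary derivatives along a line. *)
Lemma derive_line (W : normedModType R) (F : W -> R) (G : R -> R) (v z : W) (dG : R) :
  (forall h : R, F (h *: v + z) = G h) -> is_derive (0 : R) (1 : R) G dG ->
  'D_v F z = dG.
Proof.
move=> FG [_ <-]; rewrite /derive.
set a := (X in lim (X @ _)); set b := (X in _ = lim (X @ _)).
suff -> : a = b by [].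
apply/funext => h; rewrite /a /b /= FG -[z in F z]add0r -(scale0r v) FG addr0.
by rewrite [_ *: 1]mulr1.
Qed.

Definition tensor (al : R -> R) (b : 'rV[R]_n -> R) (z : V) : R := al z.1 * b z.2.

Lemma derive_dt_tensor (al : R -> R) b : smooth al ->
  'D_(dt R n) (tensor al b) = tensor (al^`()%classic) b.
Proof.
move=> sal; apply/funext => -[t x].
apply: (@derive_line _ _ (fun h => b x * al (h + t))).
  by move=> h; rewrite /tensor /= [h *: 1]mulr1 scaler0 add0r mulrC.
rewrite /tensor mulrC.
have H : is_derive (0 : R) (1 : R) (fun h => al (h + t)) (al^`()%classic t).
  rewrite -[al^`()%classic t]mulr1 -{2}[t]add0r.
  apply: (@is_derive_compR R R al (fun h => h + t)).
    exact: smooth_is_derive.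
  rewrite -[1 in X in is_derive _ _ _ X]addr0.
  apply: (@is_deriveD R R R id (cst t)).
exact: (@is_deriveZ R R R _ (b x) _ _ _ H).
Qed.

Lemma derive_dx_tensor (al : R -> R) (g : R -> R) r i : smooth g ->
  'D_(dx R i) (tensor al (space_rep r g i)) =
  tensor al (fun x => r^-1 * space_rep r (g^`()%classic) i x).
Proof.
move=> sg; apply/funext => -[t x].
pose K := al t * \prod_(j < n | j != i) c (x 0 j / r).
apply: (@derive_line _ _ (fun h => K * g ((h + x 0 i) / r))).
  move=> h; rewrite /tensor /= scaler0 add0r /K -mulrA; congr (_ * _).
  rewrite /space_rep (bigD1 i)//= eqxx mulrC; congr (_ * _).
    apply: eq_bigr => j /negbTE ji; rewrite ji !mxE ji /= mulr0 add0r//.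
  by rewrite !mxE !eqxx mulr1.
have -> : tensor al (fun x => r^-1 * space_rep r g^`()%classic i x) (t, x) =
    K * (g^`()%classic ((0 + x 0 i) / r) * (1 * r^-1)).
  rewrite /tensor /= /space_rep (bigD1 i)//= eqxx add0r /K mul1r.
  rewrite (eq_bigr (fun j => c (x 0 j / r))); last by move=> j /negbTE ->.
  ring.
have H : is_derive (0 : R) (1 : R) (fun h => g ((h + x 0 i) / r))
   (g^`()%classic ((0 + x 0 i) / r) * (1 * r^-1)).
  apply: (@is_derive_compR R R g (fun h => (h + x 0 i) / r)).
    exact: smooth_is_derive.
  have H1 : is_derive (0 : R) (1 : R) (fun h : R => h + x 0 i) 1.
    rewrite -[1 in X in is_derive _ _ _ X]addr0.
    exact: (@is_deriveD R R R id (cst (x 0 i))).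
  rewrite mulrC; rewrite (_ : (fun h => _) = fun h => r^-1 * (h + x 0 i)).
    exact: (@is_deriveZ R R R _ r^-1 _ _ _ H1).
  by apply/funext => h; rewrite mulrC.
exact: (@is_deriveZ R R R _ K _ _ _ H).
Qed.

Lemma space_rep_id r i : space_rep r c i = @space_cut R n r.
Proof. by apply/funext => x; apply: eq_bigr => j _; rewrite if_same. Qed.

Lemma laplacian_tensor (al : R -> R) r :
  laplacian (tensor al (space_cut r)) = tensor al (space_lap r).
Proof.
apply/funext => -[t x]; rewrite /laplacian /tensor /= /space_lap mulr_sumr.
apply: eq_bigr => i _; rewrite -(space_rep_id r i) derive_dx_tensor; last first.
  exact: smooth_cutoff.
have -> : tensor al (fun x => r^-1 * space_rep r c1 i x) =
   tensor (fun t => al t * r^-1) (space_rep r c1 i).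
  by apply/funext => z; rewrite /tensor mulrA.
have /(congr1 (fun F => F (t, x))) -> := @derive_dx_tensor (fun t => al t * r^-1)
  c1 r i (smooth_derive1 (@smooth_cutoff R n)).
by rewrite /tensor /= -!mulrA; congr (_ * _); rewrite mulrA -invfM -expr2.
Qed.

Lemma smooth_tensor_cut (al : R -> R) r : smooth al ->
  smooth (tensor al (space_cut r)).
Proof.
move=> sal k; apply: CkM; first exact: (Ck_comp (sal k) (Ck_fst _ _ _)).
apply: Ck_prod => i; apply: (@Ck_comp R _ k c (fun z : V => z.2 0 i * r^-1)).
  exact: smooth_cutoff.
by apply: CkM; [exact: Ck_coord|exact: Ck_cst].
Qed.

(** The time factor is only required to vanish outside [de, rho], where
    [0 < de] and [rho < T]; the support is then inside the compact
    [de, rho] x box r. *)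
Lemma test_tensor_cut (al : R -> R) r (de rho : R) (T : \bar R) : smooth al ->
  0 < r -> 0 < de -> (rho%:E < T)%E -> (forall t, t < de -> al t = 0) ->
  (forall t, rho < t -> al t = 0) ->
  test_function [set z : V | 0 < z.1 /\ (z.1%:E < T)%E] (tensor al (space_cut r)).
Proof.
move=> sal r0 de0 rhoT al1 al2.
pose K : set V := `[de, rho]%classic `*` @box R n r.
have cK : compact K.
  apply: compact_setX; first exact: segment_compact.
  rewrite (_ : box r = [set v | forall i, `[- (2 * r), 2 * r]%classic (v 0 i)]).
    by apply: (@rV_compact R n (fun=> `[- (2 * r), 2 * r]%classic)) => i; exact: segment_compact.
  by apply/seteqP; split => x bx i; have := bx i; rewrite /= in_itv/= ler_norml.
have suppK : supp (tensor al (space_cut r)) `<=` K.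
  have -> : K = closure K.
    by apply/closure_id; apply: compact_closed => //; exact: norm_hausdorff.
  apply: closure_subset => -[t x] /= tx0; split => /=.
    rewrite in_itv/=; apply/andP; split; rewrite leNgt; apply: contra tx0 => H.
      by rewrite /tensor/= al1 ?mul0r.
    by rewrite /tensor/= al2 ?mul0r.
  apply: contrapT => nbx; move/negP: tx0; apply.
  by rewrite /tensor /= space_cut_box// mulr0.
split.
- exact: smooth_tensor_cut.
- by apply: subclosed_compact suppK => //; exact: closed_closure.
- move=> z /suppK[/=]; rewrite in_itv/= => /andP[z1 z2] _; split.
    exact: lt_le_trans z1.
  by apply: le_lt_trans rhoT; rewrite lee_fin.
Qed.

End TestFunction.

(** * Time regularity and time integrals *)

Section Curves.
Variables (R : realType) (n : nat) (T : \bar R).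
Local Notation mu := (lebesgue_rV R n).
Local Notation I := (time_interval T).
Implicit Types (u v : R -> 'rV[R]_n -> R) (b : 'rV[R]_n -> R).

Lemma near_within_L2 (F : set_system R) {FF : Filter F} u :
  continuous_curve (@L2 R n) (@L2norm R n) T u ->
  \forall s \near within I F, u s \in Lfun mu 2%:E.
Proof.
by move=> cu; rewrite near_withinE; apply: nearW => s /cu[].
Qed.

Lemma curve_l2norm_cvg u t :
  continuous_curve (@L2 R n) (@L2norm R n) T u -> I t ->
  l2norm mu (fun x => u s x - u t x) @[s --> within I (nbhs t)] --> 0.
Proof. by move=> cu /cu[_ H]; exact: (fine_cvg H). Qed.

Lemma pairing_continuous u b :
  continuous_curve (@L2 R n) (@L2norm R n) T u -> b \in Lfun mu 2%:E ->
  {within I, continuous (fun t => \int[mu]_x (u t x * b x))}.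
Proof.
move=> cu bL; apply/subspace_continuousP => t It.
apply: pairing_cvg => //; first exact: near_within_L2.
  by case: (cu t It).
exact: curve_l2norm_cvg.
Qed.

Lemma powR_continuous u b p :
  continuous_curve (@L2 R n) (@L2norm R n) T u -> b \in Lfun mu 2%:E ->
  mu.-integrable setT (EFin \o b) -> (forall x, 0 <= b x <= 1) ->
  1 <= p -> p <= 2 ->
  {within I, continuous (fun t => \int[mu]_x (`|u t x| `^ p * b x))}.
Proof.
move=> cu bL bI b01 p1 p2; apply/subspace_continuousP => t It.
apply: powR_cvg => //; first exact: near_within_L2.
  by case: (cu t It).
exact: curve_l2norm_cvg.
Qed.

Lemma time_interval_nbhs t : 0 < t -> (t%:E < T)%E -> nbhs t I.
Proof.
move=> t0 tT; have : \forall s \near t, 0 < s by exact: lt_nbhsr.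
have : \forall s \near t, (s%:E < T)%E.
  case: T tT => [r| |] // tT; last by near=> s; exact: ltry.
  by rewrite lte_fin in tT; near=> s; rewrite lte_fin; near: s; exact: lt_nbhsl.
by apply: filterS2 => s sT s0; split=> //; exact: ltW.
Unshelve. all: by end_near. Qed.

(** The difference quotients converge in L^2 by hypothesis, and pairing with
    [b] is continuous there.  The hypothesis speaks of a filter restricted to the
    time interval, a neighbourhood of [t] as [t] is interior. *)
Lemma pairing_derive u v b t : C1_L2 T u v -> b \in Lfun mu 2%:E ->
  0 < t -> (t%:E < T)%E ->
  is_derive t (1 : R) (fun t => \int[mu]_x (u t x * b x)) (\int[mu]_x (v t x * b x)).
Proof.
move=> [cu cv duv] bL t0 tT; have It : I t by split=> //; exact: ltW.
have uL s : I s -> u s \in Lfun mu 2%:E by move=> /cu[].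
have vL : v t \in Lfun mu 2%:E by case: (cv t It).
have H : (s - t)^-1 * (\int[mu]_x (u s x * b x) - \int[mu]_x (u t x * b x))
    @[s --> within I t^'] --> \int[mu]_x (v t x * b x).
  have H : \int[mu]_x ((s - t)^-1 * (u s x - u t x) * b x) @[s --> within I t^'] -->
      \int[mu]_x (v t x * b x).
    apply: (@pairing_cvg _ _ R mu R (within I t^') _
      (fun s x => (s - t)^-1 * (u s x - u t x)) (v t) b _ vL bL); last first.
      by apply: (fine_cvg (duv t It)).
    rewrite near_withinE; apply: nearW => s Is.
    by apply: Lfun2Z; apply: Lfun2B; exact: uL.
  apply: cvg_trans H; apply: near_eq_cvg; rewrite near_withinE.
  apply: nearW => s Is.
  under eq_Rintegral do rewrite -mulrA.
  rewrite RintegralZl//; last by apply: Lfun2M_integrable => //; apply: Lfun2B; exact: uL.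
  congr (_ * _); under eq_Rintegral do rewrite mulrBl.
  by rewrite RintegralB//; apply: Lfun2M_integrable => //; exact: uL.
set m := fun t : R => _.
have D : h^-1 *: ((m \o shift t) (h *: (1 : R)) - m t) @[h --> 0^'] --> \int[mu]_x (v t x * b x).
  apply/cvgrPdist_le => e e0.
  move/cvgrPdist_le : H => /(_ e e0); rewrite near_withinE near_withinE.
  move=> H1; have := time_interval_nbhs t0 tT; rewrite nbhs_nearE => H2.
  have : \forall s \near t, s != t -> `|\int[mu]_x (v t x * b x) -
      (s - t)^-1 * (m s - m t)| <= e.
    by near=> s => st; apply: (near H1 s) => //; apply: (near H2 s).
  rewrite (near_shift 0 t) => H3; rewrite near_withinE.
  apply: filterS H3 => h; rewrite /= subr0 addrK [h *: 1]mulr1 => Hh h0.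
  by apply: Hh; rewrite -subr_eq0 addrK.
by split; [exact: cvgP D|exact: cvg_lim D].
Unshelve. all: by end_near. Qed.

End Curves.

Section TimeIntegrals.
Variables (R : realType) (T : \bar R).
Local Notation la := (@lebesgue_measure R).
Local Notation I := (time_interval T).
Implicit Types (F G : R -> R) (rho de : R).

Lemma measurable_time_interval : measurable (I : set (measurableTypeR R)).
Proof.
case: T => [r| |].
- rewrite (_ : time_interval _ = `[0, r[%classic)//.
  apply/seteqP; split => t; rewrite /= in_itv/=; last by move=> /andP.
  by move=> [? ?]; apply/andP.
- rewrite (_ : time_interval _ = `[0, +oo[%classic)//.
  apply/seteqP; split => t; rewrite /= in_itv/= andbT; first by case.
  by move=> t0; split=> //; exact: ltry.
- by rewrite (_ : time_interval _ = set0)// -subset0 => t [].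
Qed.

Lemma sub_time_interval rho : (rho%:E < T)%E -> `[0, rho]%classic `<=` I.
Proof.
move=> rT t; rewrite /= in_itv/= => /andP[t0 tr]; split=> //.
by apply: le_lt_trans rT; rewrite lee_fin.
Qed.

Lemma within_segment F rho : (rho%:E < T)%E -> {within I, continuous F} ->
  {within `[0, rho], continuous F}.
Proof. by move=> rT; apply: continuous_subspaceW; exact: sub_time_interval. Qed.

(** Continuity on the half-open time interval gives neither integrability nor the
    fundamental theorem of calculus; both are recovered on the compact
    [0, rho] that carries the integrand. *)
Lemma time_restrict F rho : (rho%:E < T)%E -> (forall t, rho < t -> F t = 0) ->
  F \_ I = F \_ `[0, rho]%classic.
Proof.
move=> rT F0; apply/funext => t; rewrite /patch.
have [tJ|tJ] := boolP (t \in `[0, rho]%classic).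
  by rewrite ifT//; move: tJ; rewrite !inE; exact: sub_time_interval.
case: ifPn => //; rewrite inE => -[t0 tT].
apply: F0; move: tJ; rewrite notin_setE /= in_itv/= t0/= => /negP.
by rewrite -ltNge.
Qed.

Lemma time_integrable F rho : (rho%:E < T)%E -> {within I, continuous F} ->
  (forall t, rho < t -> F t = 0) -> la.-integrable I (EFin \o F).
Proof.
move=> rT cF F0; rewrite integrable_mkcond; last exact: measurable_time_interval.
have -> : (EFin \o F) \_ I = (EFin \o F) \_ `[0, rho]%classic.
  by rewrite !restrict_EFin (time_restrict rT).
rewrite -integrable_mkcond//.
apply: continuous_compact_integrable; first exact: segment_compact.
exact: within_segment cF.
Qed.

Lemma time_integralE F rho : (rho%:E < T)%E -> (forall t, rho < t -> F t = 0) ->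
  \int[la]_(t in I) F t = \int[la]_(t in `[0, rho]) F t.
Proof.
by move=> rT F0; rewrite [LHS]Rintegral_mkcond [RHS]Rintegral_mkcond (time_restrict rT).
Qed.

Lemma time_parts (m dm eta : R -> R) rho : 0 < rho -> (rho%:E < T)%E ->
  {within I, continuous m} -> {within I, continuous dm} ->
  (forall t, 0 < t -> (t%:E < T)%E -> is_derive t (1 : R) m (dm t)) ->
  smooth eta -> eta 0 = 0 -> (forall t, rho <= t -> eta t = 0) ->
  \int[la]_(t in I) (m t * eta^`()%classic t) = - \int[la]_(t in I) (dm t * eta t).
Proof.
move=> rho0 rT cm cdm mdm seta eta0 etarho.
have ends (F : R -> R) : {within `[0, rho], continuous F} ->
   F @ 0^'+ --> F 0 /\ F @ rho^'- --> F rho.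
  by move=> /(continuous_within_itvP _ rho0)[].
have sub t : t \in `]0, rho[ -> 0 < t /\ (t%:E < T)%E.
  rewrite in_itv/= => /andP[t0 tr]; split=> //.
  by apply: lt_trans rT; rewrite lte_fin.
have deta0 t : rho < t -> eta^`()%classic t = 0.
  move=> tr; apply: (@derive1_near_cst _ _ 0).
  by near=> s; apply: etarho; rewrite ltW//; near: s; exact: lt_nbhsr.
rewrite (@time_integralE (fun t => m t * eta^`()%classic t) rho)//; last first.
  by move=> t /deta0 ->; rewrite mulr0.
rewrite (@time_integralE (fun t => dm t * eta t) rho)//; last first.
  by move=> t /ltW/etarho ->; rewrite mulr0.
have ceta : continuous eta := seta 0%N.
have cdeta : continuous eta^`()%classic := smooth_derive1 seta 0%N.
rewrite (@Rintegration_by_parts _ m eta dm)//.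
- by rewrite eta0 (etarho rho)// !mulr0 subrr sub0r.
- exact: within_segment cdm.
- have [m0 mrho] := ends m (within_segment rT cm).
  split=> // t /sub[t0 tT]; exact: (@ex_derive _ _ _ _ _ _ _ (mdm t t0 tT)).
- by move=> t /sub[t0 tT]; rewrite derive1E; case: (mdm t t0 tT).
- exact: continuous_subspaceT.
- have [m0 mrho] := ends eta (continuous_subspaceT ceta).
  split=> // t _; exact: (@ex_derive _ _ _ _ _ _ _ (smooth_is_derive seta t)).
Unshelve. all: by end_near. Qed.

Lemma time_derive_integral (eta : R -> R) rho : 0 < rho -> (rho%:E < T)%E ->
  smooth eta -> eta 0 = 0 -> (forall t, rho <= t -> eta t = 1) ->
  \int[la]_(t in I) eta^`()%classic t = 1.
Proof.
move=> rho0 rT seta eta0 etarho.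
have deta0 t : rho < t -> eta^`()%classic t = 0.
  move=> tr; apply: (@derive1_near_cst _ _ 1).
  by near=> s; apply: etarho; rewrite ltW//; near: s; exact: lt_nbhsr.
rewrite (time_integralE rT)//.
have ceta : continuous eta := seta 0%N.
have cdeta : continuous eta^`()%classic := smooth_derive1 seta 0%N.
rewrite /Rintegral (@continuous_FTC2 _ _ eta)//.
- by rewrite etarho// eta0 -EFinB subr0.
- exact: continuous_subspaceT.
- have /(continuous_within_itvP _ rho0)[_ ? ?] :=
    continuous_subspaceT (A := `[0, rho]%classic) ceta.
  split=> // t _; exact: (@ex_derive _ _ _ _ _ _ _ (smooth_is_derive seta t)).
Unshelve. all: by end_near. Qed.

Lemma within_mul (f g : R -> R) : {within I, continuous f} -> {within I, continuous g} ->
  {within I, continuous (fun t => f t * g t)}.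
Proof. by move=> cf cg t; apply: cvgM; [exact: cf|exact: cg]. Qed.

Lemma within_add (f g : R -> R) : {within I, continuous f} -> {within I, continuous g} ->
  {within I, continuous (fun t => f t + g t)}.
Proof. by move=> cf cg t; apply: cvgD; [exact: cf|exact: cg]. Qed.

Lemma within_opp (f : R -> R) : {within I, continuous f} ->
  {within I, continuous (fun t => - f t)}.
Proof. by move=> cf t; apply: cvgN; exact: cf. Qed.

Lemma within_smooth (f : R -> R) : smooth f -> {within I, continuous f}.
Proof. by move=> sf; apply: continuous_subspaceT; exact: (sf 0%N). Qed.

End TimeIntegrals.

(** * The onset near time zero *)

Section TimeCutoffs.
Variable R : realType.
Implicit Types (t s de r : R).

Lemma smooth_affine (g : R -> R) (a b : R) : smooth g -> smooth (fun t => g (t * a + b)).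
Proof.
move=> sg k; apply: (@Ck_comp R _ k g (fun t : R => t * a + b)) => //.
apply: CkD; last exact: Ck_cst.
by apply: CkM; [exact: Ck_id|exact: Ck_cst].
Qed.

Lemma smooth_cutoff_scaled (g : R -> R) r a : smooth g ->
  smooth (fun t => a * g (t / r)).
Proof.
move=> sg k; apply: CkM; first exact: Ck_cst.
rewrite (_ : (fun t => _) = fun t => g (t * r^-1 + 0)).
  exact: smooth_affine.
by apply/funext => t; rewrite addr0.
Qed.

Lemma derive1_scale (g : R -> R) s : smooth g ->
  (fun t => g (t / s))^`()%classic = (fun t => s^-1 * g^`()%classic (t / s)).
Proof.
move=> sg; apply/funext => t; rewrite derive1E.
have H1 : is_derive t (1 : R) (fun t : R => t / s) (s^-1).
  rewrite (_ : (fun t => _) = fun t => s^-1 * t); last first.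
    by apply/funext => y; rewrite mulrC.
  rewrite -[X in is_derive _ _ _ X]mulr1.
  exact: (@is_deriveZ R R R id s^-1 t 1 1 (is_derive_id _ _)).
have [_ ->] := @is_derive_compR R R g (fun t => t / s) _ _ _ _ (smooth_is_derive sg (t / s)) H1.
by rewrite mulrC.
Qed.

Definition onset de t : R := step (t / de - 1).

Lemma smooth_onset de : smooth (onset de).
Proof. exact: smooth_affine (@smooth_step R). Qed.

Lemma onset_ge0 de t : 0 <= onset de t. Proof. exact: step_ge0. Qed.
Lemma onset_le1 de t : onset de t <= 1. Proof. exact: step_le1. Qed.

Lemma onset_eq0 de t : 0 < de -> t <= de -> onset de t = 0.
Proof. by move=> de0 tde; rewrite /onset step_le0// subr_le0 ler_pdivrMr// mul1r. Qed.

Lemma onset_eq1 de t : 0 < de -> 2 * de <= t -> onset de t = 1.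
Proof. by move=> de0 tde; rewrite /onset step_ge1// lerBrDr ler_pdivlMr. Qed.

Lemma donset_eq0 de t : 0 < de -> (t < de \/ 2 * de < t) -> (onset de)^`()%classic t = 0.
Proof.
move=> de0 [tde|tde].
  apply: (@derive1_near_cst _ _ 0); near=> s; rewrite onset_eq0// ltW//.
  by near: s; exact: lt_nbhsl.
apply: (@derive1_near_cst _ _ 1); near=> s; rewrite onset_eq1// ltW//.
by near: s; exact: lt_nbhsr.
Unshelve. all: by end_near. Qed.

Lemma donset_ge0 de t : 0 < de -> 0 <= (onset de)^`()%classic t.
Proof.
move=> de0; have H1 : is_derive t (1 : R) (fun t : R => t / de - 1) (de^-1).
  rewrite (_ : (fun t => _) = fun t => de^-1 * t - 1); last first.
    by apply/funext => y; rewrite mulrC.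
  have H := @is_deriveZ R R R id de^-1 t 1 1 (is_derive_id _ _).
  have := @is_deriveB R R R _ (cst 1) t 1 _ _ H (is_derive_cst _ _ _).
  by rewrite subr0 [_ *: _]mulr1.
have := @is_derive_compR R R (@step R) (fun t => t / de - 1) _ _ _ _
  (smooth_is_derive (@smooth_step R) _) H1.
move=> [_ E]; have -> : (onset de)^`()%classic t = _ := etrans (derive1E _ _) E.
by rewrite mulr_ge0 ?step_derive_ge0// invr_ge0 ltW.
Qed.

Lemma near_cutoff_eq0 m s : 2 < `|s| -> \forall y \near s, @cutoff R m y = 0.
Proof. by move=> /near_plateau_eq0; apply: filterS => y y0; rewrite /cutoff y0 expr0n. Qed.

End TimeCutoffs.

Section TimeProfile.
Variables (R : realType) (n : nat).
Implicit Types (t de r : R).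
Local Notation c := (@cutoff R n).
Local Notation c1 := (c^`()%classic).
Local Notation c2 := (c^`()%classic^`()%classic).
Local Notation time_cut := (@time_cut R n).

Lemma smooth_time_cut r : smooth (time_cut r).
Proof.
rewrite (_ : time_cut r = fun t => c (t * r ^- 2 + 0)).
  exact: smooth_affine (@smooth_cutoff R n).
by apply/funext => t; rewrite addr0.
Qed.

(** The onset and the time cutoff vary on disjoint ranges, [de, 2 de] and
    [r^2, 2 r^2], so the derivatives of their product have no mixed terms. *)
Definition time_profile de r t : R := onset de t * time_cut r t.

Lemma smooth_time_profile de r : smooth (time_profile de r).
Proof. by move=> k; apply: CkM; [exact: smooth_onset|exact: smooth_time_cut]. Qed.

Lemma derive1_time_cut r : (time_cut r)^`()%classic = fun t => r ^- 2 * c1 (t / r ^+ 2).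
Proof. exact: derive1_scale (@smooth_cutoff R n). Qed.

Lemma derive2_time_cut r t :
  (time_cut r)^`()%classic^`()%classic t = r ^- 4 * c2 (t / r ^+ 2).
Proof.
have sc1 : smooth c1 := smooth_derive1 (@smooth_cutoff R n).
rewrite derive1_time_cut derive1E.
have H : is_derive t (1 : R) (fun t => c1 (t / r ^+ 2)) (r ^- 2 * c2 (t / r ^+ 2)).
  have /(congr1 (fun F => F t)) <- := derive1_scale (r ^+ 2) sc1.
  apply: smooth_is_derive; rewrite (_ : (fun t => _) = fun t => c1 (t * r ^- 2 + 0)).
    exact: smooth_affine.
  by apply/funext => y; rewrite addr0.
have [_ ->] := @is_deriveZ R R R _ (r ^- 2) _ _ _ H.
by rewrite [_ *: _]mulrA -invfM -exprD.
Qed.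

Lemma time_cut_eq1 r t : 0 < r -> `|t| <= r ^+ 2 -> time_cut r t = 1.
Proof.
by move=> r0 tr; rewrite /time_cut cutoff_eq1// normr_scale_le ?exprn_gt0// mul1r.
Qed.

Lemma donset_out de r t : 0 < de -> 2 * de < r ^+ 2 -> r ^+ 2 <= `|t| ->
  (onset de)^`()%classic t = 0.
Proof.
move=> de0 der tr; apply: donset_eq0 => //.
by have := tr; rewrite ler_normr => /orP[]; [right|left]; lra.
Qed.

Lemma derive1_prod (f g : R -> R) t : smooth f -> smooth g ->
  (fun t => f t * g t)^`()%classic t = f^`()%classic t * g t + f t * g^`()%classic t.
Proof.
move=> sf sg; rewrite derive1E.
have [_ ->] := @is_deriveM R R _ _ _ _ _ _ (smooth_is_derive sf t) (smooth_is_derive sg t).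
by rewrite ![_ *: _]/(_ * _) addrC; congr (_ + _); rewrite mulrC.
Qed.

Lemma derive1_sum (f g : R -> R) t : smooth f -> smooth g ->
  (fun t => f t + g t)^`()%classic t = f^`()%classic t + g^`()%classic t.
Proof.
move=> sf sg; rewrite derive1E.
by have [_ ->] := @is_deriveD R R R _ _ _ _ _ _ (smooth_is_derive sf t) (smooth_is_derive sg t).
Qed.

(** Stated for arbitrary smooth functions, the derivative of the first
    vanishing wherever the second differs from 1. *)
Section abstract_product.
Variables f g : R -> R.
Hypotheses (sf : smooth f) (sg : smooth g).
Hypothesis flat_fg : forall t, f^`()%classic t * g t = f^`()%classic t.

Lemma derive1_prod_flat :
  (fun t => f t * g t)^`()%classic = fun t => f^`()%classic t + f t * g^`()%classic t.
Proof. by apply/funext => t; rewrite derive1_prod// flat_fg. Qed.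

Lemma derive2_prod_flat t : f^`()%classic t * g^`()%classic t = 0 ->
  (fun t => f t * g t)^`()%classic^`()%classic t =
  f^`()%classic^`()%classic t + f t * g^`()%classic^`()%classic t.
Proof.
move=> fg0; have sg' := smooth_derive1 sg; rewrite derive1_prod_flat derive1_sum.
- by rewrite derive1_prod// fg0 add0r.
- exact: smooth_derive1.
- by move=> k; apply: CkM; [exact: sf|exact: sg'].
Qed.

End abstract_product.

Lemma donset_time_cut de r t : 0 < r -> 0 < de -> 2 * de < r ^+ 2 ->
  (onset de)^`()%classic t * time_cut r t = (onset de)^`()%classic t.
Proof.
move=> r0 de0 der; have [tr|tr] := leP `|t| (r ^+ 2).
  by rewrite time_cut_eq1// mulr1.
by rewrite (donset_out de0 der (ltW tr)) mul0r.
Qed.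

Lemma donset_dtime_cut de r t : 0 < r -> 0 < de -> 2 * de < r ^+ 2 ->
  (onset de)^`()%classic t * (time_cut r)^`()%classic t = 0.
Proof.
move=> r0 de0 der; have [tr|tr] := ltP `|t| (r ^+ 2); last first.
  by rewrite (donset_out de0 der tr) mul0r.
have /(congr1 (fun F => F t)) -> := derive1_time_cut r.
rewrite cutoff_derive1_eq0 ?mulr0//.
by rewrite normrM normfV (gtr0_norm (exprn_gt0 _ r0)) ltr_pdivrMr ?exprn_gt0// mul1r.
Qed.

Lemma derive1_time_profile de r t : 0 < r -> 0 < de -> 2 * de < r ^+ 2 ->
  (time_profile de r)^`()%classic t =
  (onset de)^`()%classic t + onset de t * (r ^- 2 * c1 (t / r ^+ 2)).
Proof.
move=> r0 de0 der.
have H := derive1_prod_flat (smooth_onset de) (smooth_time_cut r)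
  (fun s => donset_time_cut s r0 de0 der).
apply: etrans (congr1 (fun F => F t) H) _.
by have /(congr1 (fun F => F t)) -> := derive1_time_cut r.
Qed.

Lemma derive2_time_profile de r t : 0 < r -> 0 < de -> 2 * de < r ^+ 2 ->
  (time_profile de r)^`()%classic^`()%classic t =
  (onset de)^`()%classic^`()%classic t + onset de t * (r ^- 4 * c2 (t / r ^+ 2)).
Proof.
move=> r0 de0 der.
have H := derive2_prod_flat (smooth_onset de) (smooth_time_cut r)
  (fun s => donset_time_cut s r0 de0 der) (donset_dtime_cut t r0 de0 der).
by rewrite -derive2_time_cut; exact: H.
Qed.

Lemma cutoff_scaled_out r t : 0 < r -> 2 * r ^+ 2 < t ->
  [/\ time_cut r t = 0, c1 (t / r ^+ 2) = 0 & c2 (t / r ^+ 2) = 0].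
Proof.
move=> r0 tr; have r20 : 0 < r ^+ 2 by rewrite exprn_gt0.
have ts : 2 < `|t / r ^+ 2|.
  by rewrite (lt_le_trans _ (ler_norm _))// ltr_pdivlMr.
split; first by rewrite -[LHS]/(c (t / r ^+ 2)) cutoff_eq0// ltW.
  exact: derive1_near_cst (near_cutoff_eq0 n ts).
exact: derive1_near_cst (near_derive1 (near_cutoff_eq0 n ts)).
Qed.

End TimeProfile.

(** * The weak form of the equation at scale r *)

Section CutoffIntegrability.
Variables (R : realType) (n : nat).
Local Notation mu := (lebesgue_rV R n).
Implicit Types r : R.

Lemma space_cut_L2 r : 0 < r ->
  @space_cut R n r \in Lfun mu 2%:E /\ mu.-integrable setT (EFin \o @space_cut R n r).
Proof.
move=> r0; apply: (@box_bounded_L2 _ _ r 1) => //; first exact: measurable_space_cut.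
move=> x; rewrite ger0_norm ?space_cut_ge0// mul1r indicE.
have [bx|nbx] := pselect (box r x); first by rewrite mem_set// space_cut_le1.
by rewrite space_cut_box.
Qed.

Lemma space_lap_L2 r : (0 < n)%N -> 0 < r -> @space_lap R n r \in Lfun mu 2%:E.
Proof.
move=> n0 r0; have [C C0 HC] := @cutoff_derive_le R n.
have [] // := @box_bounded_L2 R n r (\sum_(i < n) r ^- 2 * C) (space_lap r) r0.
  exact: measurable_space_lap.
move=> x; rewrite /space_lap (le_trans (ler_norm_sum _ _ _))// mulr_suml.
apply: ler_sum => i _; rewrite normrM ger0_norm; last first.
  by rewrite invr_ge0 exprn_ge0// ltW.
rewrite -mulrA ler_wpM2l//; first by rewrite invr_ge0 exprn_ge0// ltW.
have /le_trans : `|space_rep r (cutoff n)^`()%classic^`()%classic i x| <=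
    C * space_plateau r x ^+ n.
  by apply: space_rep_le => // s; case: (HC s).
apply; rewrite ler_wpM2l// indicE.
have [bx|nbx] := pselect (box r x).
  by rewrite mem_set// exprn_ile1 ?space_plateau_ge0 ?space_plateau_le1.
by rewrite space_plateau_box// expr0n eqn0Ngt n0.
Qed.

Lemma wave_op_L2 r t : (0 < n)%N -> 0 < r ->
  (fun x => (r ^- 4 * (@cutoff R n)^`()%classic^`()%classic (t / r ^+ 2) -
     r ^- 2 * (@cutoff R n)^`()%classic (t / r ^+ 2)) * space_cut r x -
     time_cut n r t * @space_lap R n r x) \in Lfun mu 2%:E.
Proof.
move=> n0 r0; apply: Lfun2B; apply: Lfun2Z; last exact: space_lap_L2.
by case: (space_cut_L2 r0).
Qed.

End CutoffIntegrability.

Section WaveIdentity.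
Variables (R : realType) (n : nat) (T : \bar R) (u v : R -> 'rV[R]_n -> R) (p : R).
Local Notation mu := (lebesgue_rV R n).
Local Notation la := (@lebesgue_measure R).
Local Notation I := (time_interval T).
Local Notation c := (@cutoff R n).
Local Notation c1 := (c^`()%classic).
Local Notation c2 := (c^`()%classic^`()%classic).
Local Notation time_cut := (@time_cut R n).
Implicit Types (t de r th : R).

Definition mass (w : R -> 'rV[R]_n -> R) r t : R := \int[mu]_x (w t x * space_cut r x).
Definition lap_mass r t : R := \int[mu]_x (u t x * space_lap r x).
Definition source_mass r t : R := \int[mu]_x (`|u t x| `^ p * space_cut r x).
(** The pairing of [u] with [wave_op r], expanded so that its continuity in time
    is visible. *)
Definition wave_mass r t : R :=
  (r ^- 4 * c2 (t / r ^+ 2) - r ^- 2 * c1 (t / r ^+ 2)) * mass u r t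
  - time_cut r t * lap_mass r t.
Definition source_integral de r : R :=
  \int[la]_(t in I) (onset de t * (time_cut r t * source_mass r t)).

Hypothesis n_gt0 : (0 < n)%N.
Hypothesis p_ge1 : 1 <= p.
Hypothesis p_le2 : p <= 2.
Hypothesis uvC1 : C1_L2 T u v.

Let uL t : I t -> u t \in Lfun mu 2%:E.
Proof. by case: uvC1 => cu _ _ /cu[]. Qed.

Lemma continuous_mass r : 0 < r -> {within I, continuous (mass u r)}.
Proof.
move=> r0; case: uvC1 => cu _ _; apply: pairing_continuous => //.
by case: (space_cut_L2 n r0).
Qed.

Lemma continuous_mass_dt r : 0 < r -> {within I, continuous (mass v r)}.
Proof.
move=> r0; case: uvC1 => _ cv _; apply: pairing_continuous => //.
by case: (space_cut_L2 n r0).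
Qed.

Lemma continuous_lap_mass r : 0 < r -> {within I, continuous (lap_mass r)}.
Proof.
move=> r0; case: uvC1 => cu _ _; apply: pairing_continuous => //.
exact: space_lap_L2.
Qed.

Lemma continuous_source_mass r : 0 < r -> {within I, continuous (source_mass r)}.
Proof.
move=> r0; case: uvC1 => cu _ _; have [bL bI] := space_cut_L2 n r0.
by apply: powR_continuous => // x; rewrite space_cut_ge0 space_cut_le1.
Qed.

Lemma continuous_wave_mass r : 0 < r -> {within I, continuous (wave_mass r)}.
Proof.
move=> r0; apply: within_add.
  apply: within_mul; last exact: continuous_mass.
  apply: within_add; last apply: within_opp; apply: within_smooth;
    apply: smooth_cutoff_scaled.
  - exact/smooth_derive1/smooth_derive1/smooth_cutoff.
  - exact/smooth_derive1/smooth_cutoff.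
apply: within_opp; apply: within_mul; last exact: continuous_lap_mass.
exact/within_smooth/smooth_time_cut.
Qed.

Lemma continuous_source_integrand de r : 0 < r ->
  {within I, continuous (fun t => onset de t * (time_cut r t * source_mass r t))}.
Proof.
move=> r0; apply: within_mul; first exact/within_smooth/smooth_onset.
apply: within_mul; first exact/within_smooth/smooth_time_cut.
exact: continuous_source_mass.
Qed.

Lemma wave_mass_out r t : 0 < r -> 2 * r ^+ 2 < t -> wave_mass r t = 0.
Proof.
move=> r0 tr; have [a0 c10 c20] := cutoff_scaled_out n r0 tr.
by rewrite /wave_mass a0 c10 c20 !mulr0 subrr !mul0r subrr.
Qed.

Lemma mass_combination r t (a b : R) : 0 < r -> I t ->
  \int[mu]_x (u t x * (a * space_cut r x - b * space_lap r x)) =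
  a * mass u r t - b * lap_mass r t.
Proof.
move=> r0 It; have [bL _] := space_cut_L2 n r0; have lL := space_lap_L2 n_gt0 r0.
have I1 := Lfun2M_integrable (uL It) bL; have I2 := Lfun2M_integrable (uL It) lL.
transitivity (\int[mu]_x (a * (u t x * space_cut r x) - b * (u t x * space_lap r x))).
  by apply: eq_Rintegral => x _; ring.
rewrite RintegralB//; first by rewrite !RintegralZl.
- exact: (integrableZl measurableT a I1).
- exact: (integrableZl measurableT b I2).
Qed.

Hypothesis waveq : damped_wave_eq p T u.

(** The equation tested against [onset de * psi r].  The second derivative of the
    onset is moved back on [u], which replaces it by [v]; what is left of the
    onset is its nonnegative derivative against [\int (v + u) psi r]. *)
Lemma wave_identity de r : 0 < r -> 0 < de -> 2 * de < r ^+ 2 ->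
  ((2 * r ^+ 2)%:E < T)%E ->
  source_integral de r + \int[la]_(t in I) ((onset de)^`()%classic t * (mass v r t + mass u r t)) =
  \int[la]_(t in I) (onset de t * wave_mass r t).
Proof.
move=> r0 de0 der rT; have r20 : 0 < 2 * r ^+ 2 by rewrite mulr_gt0// exprn_gt0.
have salpha := smooth_time_profile n de r.
have sdalpha := smooth_derive1 salpha.
have alpha_out t : 2 * r ^+ 2 < t -> time_profile n de r t = 0.
  by move=> tr; have [a0 _ _] := cutoff_scaled_out n r0 tr; rewrite /time_profile a0 mulr0.
have alpha_in t : t < de -> time_profile n de r t = 0.
  by move=> tr; rewrite /time_profile onset_eq0 ?mul0r// ltW.
have schi := smooth_onset de; have sdchi := smooth_derive1 schi.
have E := waveq (test_tensor_cut n salpha r0 de0 rT alpha_in alpha_out).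
pose phi := tensor (time_profile n de r) (@space_cut R n r).
have D1 z : 'D_(dt R n) phi z = tensor (time_profile n de r)^`()%classic (space_cut r) z.
  exact: (congr1 (fun F => F z) (derive_dt_tensor (space_cut r) salpha)).
have D2 z : 'D_(dt R n) ('D_(dt R n) phi) z =
    tensor (time_profile n de r)^`()%classic^`()%classic (space_cut r) z.
  apply: etrans (congr1 (fun F => F z) (derive_dt_tensor (space_cut r) sdalpha)).
  exact: (congr1 (fun G => 'D_(dt R n) G z) (derive_dt_tensor (space_cut r) salpha)).
have D3 z : laplacian phi z = tensor (time_profile n de r) (space_lap r) z.
  exact: (congr1 (fun F => F z) (@laplacian_tensor R n (time_profile n de r) r)).
have lhsE t : I t -> \int[mu]_x (u t x *
    ('D_(dt R n) ('D_(dt R n) phi) (t, x) - laplacian phi (t, x)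
     - 'D_(dt R n) phi (t, x))) =
    (mass u r t * (onset de)^`()%classic^`()%classic t
    - (onset de)^`()%classic t * mass u r t) + onset de t * wave_mass r t.
  move=> It; transitivity (\int[mu]_x (u t x *
      (((time_profile n de r)^`()%classic^`()%classic t - (time_profile n de r)^`()%classic t)
         * space_cut r x - time_profile n de r t * space_lap r x))).
    by apply: eq_Rintegral => x _; rewrite D1 D2 D3 /tensor/=; ring.
  rewrite (mass_combination _ _ r0 It) (derive1_time_profile n t r0 de0 der).
  rewrite (derive2_time_profile n t r0 de0 der) /time_profile /wave_mass.
  move: (mass u r t) (lap_mass r t) (onset de t) (time_cut r t) => A B C D.
  move: (c1 _) (c2 _) ((onset de)^`()%classic t) ((onset de)^`()%classic^`()%classic t).
  by move=> *; ring.
have rhsE t : I t -> \int[mu]_x (`|u t x| `^ p * phi (t, x)) =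
   onset de t * (time_cut r t * source_mass r t).
  move=> It; have [bL bI] := space_cut_L2 n r0.
  transitivity (\int[mu]_x ((onset de t * time_cut r t) * (`|u t x| `^ p * space_cut r x))).
    by apply: eq_Rintegral => x _; rewrite /phi /tensor /time_profile/=; ring.
  rewrite mulrA RintegralZl//; apply: (powR_integrable (uL It)) => //.
    by move=> x; rewrite space_cut_ge0 space_cut_le1.
  by rewrite (le_trans _ p_ge1).
have {}E : source_integral de r =
    \int[la]_(t in I) ((mass u r t * (onset de)^`()%classic^`()%classic t
    - (onset de)^`()%classic t * mass u r t) + onset de t * wave_mass r t).
  transitivity (\int[la]_(t in I) \int[mu]_x (`|u t x| `^ p * phi (t, x))).
    by apply: eq_Rintegral => t; rewrite inE => It; rewrite rhsE.
  rewrite -E; apply: eq_Rintegral => t; rewrite inE => It; exact: lhsE.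
have donset_out t : 2 * r ^+ 2 < t -> (onset de)^`()%classic t = 0.
  by move=> tr; apply: donset_eq0 => //; right; lra.
have ddchi_out t : 2 * r ^+ 2 < t -> (onset de)^`()%classic^`()%classic t = 0.
  move=> tr; apply: (@derive1_near_cst _ _ 0); near=> s; apply: donset_out.
  by near: s; exact: lt_nbhsr.
have cM := continuous_mass r0; have cV := continuous_mass_dt r0.
have cdchi : {within I, continuous (onset de)^`()%classic} by exact: within_smooth.
have cddchi : {within I, continuous (onset de)^`()%classic^`()%classic}.
  exact/within_smooth/smooth_derive1.
have cchi : {within I, continuous (onset de)} by exact: within_smooth.
have i1 : la.-integrable I (EFin \o (fun t => mass u r t * (onset de)^`()%classic^`()%classic t)).
  apply: (time_integrable rT) => [|t /ddchi_out ->]; last by rewrite mulr0.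
  exact: within_mul.
have i2 : la.-integrable I (EFin \o (fun t => (onset de)^`()%classic t * mass u r t)).
  apply: (time_integrable rT) => [|t /donset_out ->]; last by rewrite mul0r.
  exact: within_mul.
have i3 : la.-integrable I (EFin \o (fun t => onset de t * wave_mass r t)).
  apply: (time_integrable rT) => [|t /(wave_mass_out r0) ->]; last by rewrite mulr0.
  by apply: within_mul => //; exact: continuous_wave_mass.
have i4 : la.-integrable I (EFin \o (fun t => (onset de)^`()%classic t * mass v r t)).
  apply: (time_integrable rT) => [|t /donset_out ->]; last by rewrite mul0r.
  exact: within_mul.
have mI := measurable_time_interval T.
have i12 := integrableB mI i1 i2.
have parts : \int[la]_(t in I) (mass u r t * (onset de)^`()%classic^`()%classic t) =
    - \int[la]_(t in I) ((onset de)^`()%classic t * mass v r t).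
  rewrite (time_parts r20 rT cM cV _ sdchi).
  - by congr (- _); apply: eq_Rintegral => t _; rewrite mulrC.
  - by move=> t t0 tT; exact: (pairing_derive uvC1 (space_cut_L2 n r0).1 t0 tT).
  - by apply: donset_eq0 => //; left.
  - move=> t tr; apply: donset_eq0 => //; right.
    by apply: lt_le_trans tr; nra.
rewrite E RintegralD// RintegralB// parts.
under [X in _ + X]eq_Rintegral do rewrite mulrDr.
rewrite RintegralD//; move: (Rintegral _ _ _) (Rintegral _ _ _) (Rintegral _ _ _).
by move=> *; ring.
Unshelve. all: by end_near. Qed.

Variable C : R.
Hypothesis C_gt0 : 0 < C.
Hypothesis C_young : young_constant n C.
Hypothesis pE : p = 1 + 2 / n%:R.

(** [wave_op_young] with [y = |u t x|], integrated in space. *)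
Lemma wave_mass_le r t th : 1 <= r -> 0 < th -> I t ->
  wave_mass r t <= C / r ^+ 2 * (th * (time_cut r t * source_mass r t
    - time_cut (r / 2) t * source_mass (r / 2) t) + th `^ (- (n%:R / 2)) * (4 * r) ^+ n).
Proof.
move=> r1 th0 It.
have r0 : 0 < r by rewrite (lt_le_trans ltr01).
have r20 : 0 < r / 2 by rewrite divr_gt0.
have p0 : 0 <= p by rewrite (le_trans _ p_ge1).
have powI s : 0 < s -> mu.-integrable setT (EFin \o (fun x => `|u t x| `^ p * space_cut s x)).
  move=> s0; have [bL bI] := space_cut_L2 n s0.
  apply: (powR_integrable (uL It)) => // x.
  by rewrite space_cut_ge0 space_cut_le1.
have boxI := box_indic_integrable n r0.
set A := fun x : 'rV[R]_n => th * (time_cut r t * (`|u t x| `^ p * space_cut r x)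
    - time_cut (r / 2) t * (`|u t x| `^ p * space_cut (r / 2) x)).
set B := fun x : 'rV[R]_n => th `^ (- (n%:R / 2)) * \1_(box r) x.
have AI : mu.-integrable setT (EFin \o A).
  exact: (integrableZl measurableT th (integrableB measurableT
    (integrableZl measurableT (time_cut r t) (powI _ r0))
    (integrableZl measurableT (time_cut (r / 2) t) (powI _ r20)))).
have BI : mu.-integrable setT (EFin \o B) by exact: (integrableZl measurableT _ boxI).
have ABI : mu.-integrable setT (EFin \o (fun x => A x + B x)).
  exact: (integrableD measurableT AI BI).
have intA : \int[mu]_x A x = th * (time_cut r t * source_mass r t
    - time_cut (r / 2) t * source_mass (r / 2) t).
  rewrite RintegralZl//; last first.
    exact: (integrableB measurableT
      (integrableZl measurableT (time_cut r t) (powI _ r0))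
      (integrableZl measurableT (time_cut (r / 2) t) (powI _ r20))).
  rewrite RintegralB//; last 2 first.
  - exact: (integrableZl measurableT (time_cut r t) (powI _ r0)).
  - exact: (integrableZl measurableT (time_cut (r / 2) t) (powI _ r20)).
  by rewrite !RintegralZl//; exact: powI.
have intB : \int[mu]_x B x = th `^ (- (n%:R / 2)) * (4 * r) ^+ n.
  rewrite RintegralZl//; congr (_ * _).
  rewrite /Rintegral integral_indic//; last exact: measurable_box.
  by rewrite setIT; have /= -> := box_measure n r0.
rewrite -intA -intB -RintegralD// -RintegralZl//.
rewrite /wave_mass -mass_combination//.
apply: le_Rintegral => //.
- exact: (Lfun2M_integrable (uL It) (wave_op_L2 t n_gt0 r0)).
- exact: (integrableZl measurableT _ ABI).
- move=> x _; apply: (le_trans (ler_norm _)); rewrite normrM.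
  have := C_young t x r1 (normr_ge0 (u t x)) th0; rewrite -pE.
  rewrite /psi /wave_op.
  move=> /le_trans; apply.
  by rewrite /A /B le_eqVlt; apply/orP; left; apply/eqP; ring.
Qed.

Lemma source_integral_segment de s rho : 0 < s -> 2 * s ^+ 2 <= rho -> (rho%:E < T)%E ->
  source_integral de s = \int[la]_(t in `[0, rho]) (onset de t * (time_cut s t * source_mass s t)).
Proof.
move=> s0 srho rT; rewrite /source_integral (time_integralE rT)// => t tr.
have [-> _ _] := cutoff_scaled_out n s0 (le_lt_trans srho tr).
by rewrite mul0r mulr0.
Qed.

(** [wave_mass_le] integrated in time over [0, 2 r^2], beyond which all cutoffs
    vanish.  The right-hand side only involves the increment of
    [source_integral] between the scales [r / 2] and [r]. *)
Lemma wave_ineq de r th : 1 <= r -> 0 < de -> 2 * de < 1 ->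
  ((2 * r ^+ 2)%:E < T)%E -> 0 < th ->
  source_integral de r + \int[la]_(t in I) ((onset de)^`()%classic t * (mass v r t + mass u r t)) <=
  C / r ^+ 2 * (th * (source_integral de r - source_integral de (r / 2))
     + th `^ (- (n%:R / 2)) * (4 * r) ^+ n * (2 * r ^+ 2)).
Proof.
move=> r1 de0 de1 rT th0.
have r0 : 0 < r by rewrite (lt_le_trans ltr01).
have r20 : 0 < r / 2 by rewrite divr_gt0.
have der : 2 * de < r ^+ 2 by rewrite (lt_le_trans de1)// exprn_ege1.
rewrite (wave_identity r0 de0 der rT) (time_integralE rT); last first.
  by move=> t /(wave_mass_out r0) ->; rewrite mulr0.
have halfle : 2 * (r / 2) ^+ 2 <= 2 * r ^+ 2 by nra.
rewrite (source_integral_segment de r0 (lexx _) rT) (source_integral_segment de r20 halfle rT).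
set kap := th `^ _ * _.
have kap0 : 0 <= kap.
  by rewrite mulr_ge0 ?powR_ge0// exprn_ge0// mulr_ge0// ltW.
have Jint (F : R -> R) : {within I, continuous F} ->
    la.-integrable `[0, 2 * r ^+ 2] (EFin \o F).
  move=> cF; apply: continuous_compact_integrable; first exact: segment_compact.
  exact: within_segment cF.
have mJ : measurable (`[0, 2 * r ^+ 2]%classic : set (measurableTypeR R)) by [].
set F1 := fun t => onset de t * (time_cut r t * source_mass r t).
set F2 := fun t => onset de t * (time_cut (r / 2) t * source_mass (r / 2) t).
have i1 : la.-integrable `[0, 2 * r ^+ 2] (EFin \o F1).
  by apply: Jint; exact: continuous_source_integrand.
have i2 : la.-integrable `[0, 2 * r ^+ 2] (EFin \o F2).
  by apply: Jint; exact: continuous_source_integrand.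
have i3 : la.-integrable `[0, 2 * r ^+ 2] (EFin \o (fun t => kap)).
  by apply: Jint; apply: within_smooth => k; exact: Ck_cst.
have i12 : la.-integrable `[0, 2 * r ^+ 2] (EFin \o (fun t => F1 t - F2 t)).
  exact: (integrableB mJ i1 i2).
have i12' : la.-integrable `[0, 2 * r ^+ 2] (EFin \o (fun t => th * (F1 t - F2 t))).
  exact: (integrableZl mJ th i12).
have i4 : la.-integrable `[0, 2 * r ^+ 2] (EFin \o (fun t => th * (F1 t - F2 t) + kap)).
  exact: (integrableD mJ i12' i3).
have -> : kap * (2 * r ^+ 2) = \int[la]_(t in `[0, 2 * r ^+ 2]) kap.
  have muJ : la `[0, 2 * r ^+ 2]%classic = (2 * r ^+ 2)%:E.
    rewrite lebesgue_measure_itv/= lte_fin ifT ?mulr_gt0 ?exprn_gt0//.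
    by rewrite -EFinB subr0.
  by rewrite Rintegral_cst//; congr (_ * _); rewrite -[LHS]/(fine (2 * r ^+ 2)%:E) -muJ.
rewrite -RintegralB// -RintegralZl// -RintegralD// -RintegralZl//.
apply: le_Rintegral => //.
- apply: Jint; apply: within_mul; first exact/within_smooth/smooth_onset.
  exact: continuous_wave_mass.
- exact: (integrableZl mJ _ i4).
move=> t tJ; have It : I t by exact: (sub_time_interval rT).
have Cr : 0 <= C / r ^+ 2 by rewrite divr_ge0 ?ltW// exprn_gt0.
apply: (le_trans (ler_wpM2l (onset_ge0 de t) (wave_mass_le r1 th0 It))).
rewrite mulrCA ler_wpM2l// mulrDr lerD//; last by rewrite ler_piMl// onset_le1.
by rewrite le_eqVlt /F1 /F2; apply/orP; left; apply/eqP; ring.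
Qed.

End WaveIdentity.

(** * The initial data *)

Section InitialLayer.
Variables (R : realType) (T : \bar R).
Local Notation la := (@lebesgue_measure R).
Local Notation I := (time_interval T).

(** The derivative of the onset is a probability density on [de, 2 de], and
    [kap < w] there if [de] is small. *)
Lemma initial_layer (w : R -> R) (kap : R) : (0 < T)%E ->
  {within I, continuous w} -> kap < w 0 ->
  exists2 e, 0 < e & forall de, 0 < de -> de < e ->
    kap <= \int[la]_(t in I) ((onset de)^`()%classic t * w t).
Proof.
move=> T0 cw kw.
have I0 : I 0 by [].
have [rho rho0 rhoT] : exists2 rho : R, 0 < rho & (rho%:E < T)%E.
  case: T T0 => [r| |]//; last by exists 1; rewrite // ltry.
  rewrite lte_fin => r0; exists (r / 2); first by rewrite divr_gt0.
  by rewrite lte_fin ltr_pdivrMr//; lra.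
move/subspace_continuousP : cw => /[dup] cw' /(_ 0 I0) w0.
have cw : {within I, continuous w} by exact/subspace_continuousP.
have : \forall t \near within I (nbhs (0 : R)), kap < w t by exact: (cvgr_gt (w 0) w0).
rewrite near_withinE => /nbhs_ballP[e /= e0 He].
exists (Num.min (e / 2) (rho / 2)); first by rewrite lt_min !divr_gt0.
move=> de de0; rewrite lt_min !ltr_pdivlMr// => /andP[dee derho].
have de2 : 0 < 2 * de by rewrite mulr_gt0.
have deT : ((2 * de)%:E < T)%E by apply: lt_trans rhoT; rewrite lte_fin mulrC.
have schi := smooth_onset de; have sdchi := smooth_derive1 schi.
have out t : 2 * de < t -> (onset de)^`()%classic t = 0.
  by move=> tr; apply: donset_eq0 => //; right.
have <- : \int[la]_(t in I) ((onset de)^`()%classic t * kap) = kap.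
  rewrite RintegralZr; last 2 first.
  - exact: measurable_time_interval.
  - by apply: (time_integrable deT) => //; exact: within_smooth.
  rewrite (@time_derive_integral R T (onset de) (2 * de)) ?mul1r//.
  - by rewrite onset_eq0// ltW.
  - by move=> t; exact: onset_eq1.
apply: le_Rintegral; first exact: measurable_time_interval.
- apply: (time_integrable deT) => [|t /out ->]; last by rewrite mul0r.
  apply: within_mul; first exact: within_smooth.
  by apply: within_smooth => k; exact: Ck_cst.
- apply: (time_integrable deT) => [|t /out ->]; last by rewrite mul0r.
  by apply: within_mul => //; exact: within_smooth.
move=> t It; have [tr|tr] := leP t (2 * de); last by rewrite out// !mul0r.
rewrite ler_wpM2l ?donset_ge0// ltW//; apply: He => //.
case: It => t0 _; rewrite /ball/= sub0r normrN ger0_norm//.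
by apply: (le_lt_trans tr); rewrite mulrC.
Qed.

(** The recursion over scales compares integrals damped by one and the same
    onset, so [de] has to serve all of them. *)
Lemma initial_layers (w : nat -> R -> R) (kap : R) (N : nat) : (0 < T)%E ->
  (forall j, {within I, continuous (w j)}) -> (forall j, kap < w j 0) ->
  exists2 e, 0 < e & forall de, 0 < de -> de < e -> forall j, (j <= N)%N ->
    kap <= \int[la]_(t in I) ((onset de)^`()%classic t * w j t).
Proof.
move=> T0 cw kw; elim: N => [|N [e e0 IHe]].
  have [e e0 He] := initial_layer T0 (cw 0%N) (kw 0%N).
  by exists e => // de de0 dee j; rewrite leqn0 => /eqP ->; exact: He.
have [e' e'0 He'] := initial_layer T0 (cw N.+1) (kw N.+1).
exists (Num.min e e'); first by rewrite lt_min e0.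
move=> de de0; rewrite lt_min => /andP[dee dee'] j.
by rewrite leq_eqVlt => /predU1P[->|]; [exact: He'|exact: IHe].
Qed.

End InitialLayer.

(** * The recursion over dyadic scales *)

Section Recursion.
Variable R : realType.
Implicit Types (a b q : R).

(** The graph of the convex function [s ^ (- q)] lies above its tangent at
    [b]; after division by [b ^ (- q)], this follows from [1 + y <= exp y] at
    [y = - q * ln (a / b)] and [ln z <= z - 1] at [z = a / b]. *)
Lemma powRN_convex a b q : 0 < a -> 0 < b -> 0 <= q ->
  q * b `^ (- (1 + q)) * (b - a) <= a `^ (- q) - b `^ (- q).
Proof.
move=> a0 b0 q0; have ab0 : 0 < a / b by rewrite divr_gt0.
have H : 1 + q * (1 - a / b) <= (a / b) `^ (- q).
  rewrite /powR (gt_eqF ab0); apply: le_trans (expR_ge1Dx _).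
  rewrite lerD2l mulNr -mulrN ler_wpM2l//.
  have := expR_ge1Dx (ln (a / b)); rewrite lnK ?posrE//; lra.
have E1 : b `^ (- q) * (a / b) `^ (- q) = a `^ (- q).
  by rewrite -powRM ?ltW// mulrC divfK// gt_eqF.
have E2 : b `^ (- (1 + q)) = b `^ (- q) / b.
  rewrite opprD addrC powRD; last by rewrite (gt_eqF b0) implybT.
  by rewrite powR_inv1// ltW.
have := ler_wpM2l (powR_ge0 b (- q)) H; rewrite E1 E2 mulrDr mulr1.
have -> : b `^ (- q) * (q * (1 - a / b)) = q * (b `^ (- q) / b) * (b - a).
  by field; rewrite gt_eqF.
lra.
Qed.

(** The increment is bounded below by the new value [S j.+1], not the old one, so
    the tangent inequality at [S j.+1] shows that [S ^ (- q)] drops by at least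
    [c0 * q] at each step, however large the step is. *)
Lemma backward_euler_bound (S : nat -> R) (c0 q : R) (N : nat) : 0 < c0 -> 0 < q ->
  (forall j, (j <= N)%N -> 0 < S j) ->
  (forall j, (j < N)%N -> c0 * S j.+1 `^ (1 + q) <= S j.+1 - S j) ->
  N%:R * (c0 * q) <= S 0%N `^ (- q).
Proof.
move=> c00 q0 S0 Sstep.
suff : forall k, (k <= N)%N -> k%:R * (c0 * q) + S k `^ (- q) <= S 0%N `^ (- q).
  by move=> /(_ N (leqnn N)); have := powR_ge0 (S N) (- q); lra.
elim=> [|k IHk] kN; first by rewrite mul0r add0r.
have Sk := S0 k (ltnW kN); have Sk1 := S0 k.+1 kN.
apply: le_trans (IHk (ltnW kN)).
have := powRN_convex Sk Sk1 (ltW q0).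
have : c0 * q <= q * S k.+1 `^ (- (1 + q)) * (S k.+1 - S k).
  rewrite mulrC -mulrA ler_wpM2l ?(ltW q0)//.
  rewrite powRN mulrC ler_pdivlMr ?powR_gt0//; exact: Sstep.
rewrite -natr1 mulrDl mul1r; lra.
Qed.

(** At [th = (2 A / S) ^ (2 / n)] the second term equals [S / 2] and is absorbed
    by the left-hand side. *)
Lemma young_optimize (S D A : R) (n : nat) : (0 < n)%N -> 0 < A -> 0 < S ->
  (forall th, 0 < th -> S <= th * D + A * th `^ (- (n%:R / 2))) ->
  (2 * (2 * A) `^ (2 / n%:R))^-1 * S `^ (1 + 2 / n%:R) <= D.
Proof.
move=> n0 A0 S0 H; have nR : 0 < n%:R :> R by rewrite ltr0n.
have AS : 0 < 2 * A / S by rewrite divr_gt0// mulr_gt0.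
have := H ((2 * A / S) `^ (2 / n%:R)) (powR_gt0 _ AS).
rewrite -powRrM (_ : 2 / n%:R * - (n%:R / 2) = -1); last by field; rewrite gt_eqF.
rewrite powR_inv1 ?(ltW AS)//.
have -> : A * (2 * A / S)^-1 = S / 2.
  by field; rewrite !gt_eqF.
rewrite (@powRM _ (2 * A)) ?invr_ge0 ?mulr_ge0 ?(ltW S0) ?(ltW A0)// => HS.
have P1 : 0 < (2 * A) `^ (2 / n%:R) by rewrite powR_gt0// mulr_gt0.
have P2 : 0 < S `^ (2 / n%:R) by rewrite powR_gt0.
have E : S^-1 `^ (2 / n%:R) = (S `^ (2 / n%:R))^-1.
  by rewrite -powR_inv1 ?(ltW S0)// -powRrM mulN1r powRN.
rewrite powRD; last by rewrite (gt_eqF S0) implybT.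
rewrite powRr1 ?(ltW S0)//; rewrite ler_pdivrMl ?mulr_gt0//.
move: HS; rewrite E; move: ((2 * A) `^ _) (S `^ _) P1 P2 => P Q P1 P2 HS.
have {}HS : S / 2 <= P / Q * D by lra.
have : S / 2 * Q <= P / Q * D * Q by rewrite ler_wpM2r// ltW.
have -> : P / Q * D * Q = P * D by field; rewrite gt_eqF.
lra.
Qed.

End Recursion.

(** * Positivity of the initial mass *)

Section AlmostEverywhere.
Context d (T : measurableType d) (R : realType).
Variable mu : {measure set T -> \bar R}.

Lemma ae_Rintegral (g h : T -> R) : measurable_fun setT g -> measurable_fun setT h ->
  {ae mu, forall x, g x = h x} -> \int[mu]_x g x = \int[mu]_x h x.
Proof.
move=> mg mh gh; rewrite /Rintegral; congr fine; apply: ae_eq_integral => //.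
- exact/measurable_EFinP.
- exact/measurable_EFinP.
- by apply: filterS gh => x /= -> _.
Qed.

Lemma ae_Rintegral_ge0 (h : T -> R) : measurable_fun setT h ->
  {ae mu, forall x, 0 <= h x} -> 0 <= \int[mu]_x h x.
Proof.
move=> mh h0; rewrite (@ae_Rintegral h (fun x => `|h x|))//.
- by apply: Rintegral_ge0.
- exact: measurableT_comp.
- by apply: filterS h0 => x h0; rewrite ger0_norm.
Qed.

Lemma ae_Rintegral_eq0 (h : T -> R) : mu.-integrable setT (EFin \o h) ->
  {ae mu, forall x, 0 <= h x} -> \int[mu]_x h x <= 0 -> {ae mu, forall x, h x = 0}.
Proof.
move=> ih h0 h_le0; have mh : measurable_fun setT h.
  by apply/measurable_EFinP; exact: measurable_int ih.
have habs : \int[mu]_x h x = \int[mu]_x `|h x|.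
  apply: ae_Rintegral => //; first exact: measurableT_comp.
  by apply: filterS h0 => x h0; rewrite ger0_norm.
have E : (\int[mu]_x `|(EFin \o h) x|)%E = 0%E.
  have fin : (\int[mu]_x `|(EFin \o h) x|)%E \is a fin_num.
    exact: (integrable_fin_num measurableT (integrable_abse ih)).
  rewrite -(fineK fin); congr EFin; apply/eqP; rewrite eq_le; apply/andP; split.
    by rewrite habs in h_le0.
  by apply: fine_ge0; exact: integral_ge0.
have /(ae_eq_integral_abs _ measurableT) : measurable_fun setT (EFin \o h).
  exact/measurable_EFinP.
by move=> /(_ mu) [/(_ E) + _]; apply: filterS => x /(_ Logic.I) [].
Qed.

Lemma ae_foralln (P : nat -> T -> Prop) : (forall k, {ae mu, forall x, P k x}) ->
  {ae mu, forall x, forall k, P k x}.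
Proof.
move=> aP; have := negligible_bigcup aP; apply: negligibleS => x /= /existsNP[k nP].
by exists k.
Qed.

End AlmostEverywhere.

Section InitialData.
Variables (R : realType) (n : nat).
Local Notation mu := (lebesgue_rV R n).
Implicit Type f : 'rV[R]_n -> R.

Lemma pow2_gt0 k : 0 < 2 ^+ k :> R. Proof. by rewrite exprn_gt0. Qed.

Lemma exists_box (x : 'rV[R]_n) : exists k, forall i, `|x 0 i| <= 2 ^+ k.
Proof.
have [k Hk] : exists k, \sum_i `|x 0 i| <= 2 ^+ k.
  exists (Num.bound (\sum_i `|x 0 i|)).
  have S0 : 0 <= \sum_i `|x 0 i| by exact: sumr_ge0.
  apply: (le_trans (ltW (archi_boundP S0))).
  by rewrite -natrX ler_nat ltnW// ltn_expl.
exists k => i; apply: le_trans Hk; rewrite (bigD1 i)//= lerDl.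
exact: sumr_ge0.
Qed.

(** Otherwise [f] would vanish almost everywhere on each of countably many boxes
    exhausting the space. *)
Lemma exists_positive_mass f : f \in Lfun mu 2%:E -> {ae mu, forall x, 0 <= f x} ->
  ~ {ae mu, forall x, f x = 0} ->
  exists k, 0 < \int[mu]_x (f x * space_cut (2 ^+ k) x).
Proof.
move=> fL f0 fn0; apply: contrapT => /forallNP H; apply: fn0.
have H0 k : {ae mu, forall x, f x * space_cut (2 ^+ k) x = 0}.
  have [bL _] := space_cut_L2 n (pow2_gt0 k).
  apply: ae_Rintegral_eq0; first exact: Lfun2M_integrable.
  - by apply: filterS f0 => x f0; rewrite mulr_ge0// space_cut_ge0.
  - by rewrite leNgt; apply/negP; exact: H.
apply: filterS (ae_foralln H0) => x /= Hx; have [k xk] := exists_box x.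
by have := Hx k; rewrite space_cut_eq1 ?mulr1// pow2_gt0.
Qed.

(** A positive initial mass at one scale is thus a lower bound for all larger
    scales. *)
Lemma mass_mono f k l : (k <= l)%N -> f \in Lfun mu 2%:E ->
  {ae mu, forall x, 0 <= f x} ->
  \int[mu]_x (f x * space_cut (2 ^+ k) x) <= \int[mu]_x (f x * space_cut (2 ^+ l) x).
Proof.
move=> kl fL f0; rewrite -subr_ge0 -RintegralB//; last 2 first.
- by apply: Lfun2M_integrable => //; case: (space_cut_L2 n (pow2_gt0 l)).
- by apply: Lfun2M_integrable => //; case: (space_cut_L2 n (pow2_gt0 k)).
apply: ae_Rintegral_ge0.
  by apply: measurable_funB; apply: measurable_funM => //;
    [exact: Lfun2_measurable fL|exact: measurable_space_cut|exact: Lfun2_measurable fL|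
     exact: measurable_space_cut].
apply: filterS f0 => x f0; rewrite -mulrBr mulr_ge0// subr_ge0.
have [->//|kl'] := eqVneq k l.
apply: space_cut_mono; first exact: pow2_gt0.
by rewrite -exprS ler_weXn2l// ?ler1n// ltn_neqAle kl'.
Qed.

Lemma mass_ae_scale (eps : R) f (w : 'rV[R]_n -> R) k :
  f \in Lfun mu 2%:E -> w \in Lfun mu 2%:E -> {ae mu, forall x, w x = eps * f x} ->
  \int[mu]_x (w x * space_cut (2 ^+ k) x) = eps * \int[mu]_x (f x * space_cut (2 ^+ k) x).
Proof.
move=> fL wL wf; have [bL _] := space_cut_L2 n (pow2_gt0 k).
rewrite -RintegralZl//; last exact: Lfun2M_integrable.
apply: ae_Rintegral.
- by apply: measurable_funM; [exact: Lfun2_measurable wL|exact: measurable_space_cut].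
- apply: measurable_funM => //.
  by apply: measurable_funM; [exact: Lfun2_measurable fL|exact: measurable_space_cut].
- by apply: filterS wf => x ->; rewrite mulrA.
Qed.

End InitialData.

(** * The lifespan *)

Section Rescaling.
Variables (R : realType) (n : nat).
Implicit Types (C r th : R).

Definition scale_const C : R := 2 * C * 4 ^+ n * C^-1 `^ (- (n%:R / 2)).

Lemma scale_const_gt0 C : 0 < C -> 0 < scale_const C.
Proof. by move=> C0; rewrite !mulr_gt0 ?exprn_gt0 ?powR_gt0 ?invr_gt0. Qed.

(** Criticality: with [th] in units of [r ^ 2], the factor [r ^ (- n)] of the
    second term cancels the volume [r ^ n] of the box, and no power of the scale
    [r] is left. *)
Lemma rescale_young C r th (D : R) : 0 < C -> 0 < r -> 0 < th ->
  C / r ^+ 2 * ((r ^+ 2 * th / C) * D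
     + (r ^+ 2 * th / C) `^ (- (n%:R / 2)) * (4 * r) ^+ n * (2 * r ^+ 2))
  = th * D + scale_const C * th `^ (- (n%:R / 2)).
Proof.
move=> C0 r0 th0.
have r20 : 0 < r ^+ 2 by rewrite exprn_gt0.
have rn0 : 0 < r ^+ n by rewrite exprn_gt0.
rewrite -mulrA powRM ?mulr_ge0 ?invr_ge0 ?ltW// powRM ?invr_ge0 ?ltW//.
have -> : (r ^+ 2) `^ (- (n%:R / 2)) = (r ^+ n)^-1.
  rewrite -powR_mulrn ?(ltW r0)// -powRrM (_ : 2 * - (n%:R / 2) = - n%:R); last by field.
  by rewrite powRN powR_mulrn// ltW.
rewrite /scale_const exprMn; field.
by rewrite !gt_eqF.
Qed.

End Rescaling.

Section Lifespan.
Variables (R : realType) (n : nat).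
Local Notation mu := (lebesgue_rV R n).

(** The scales are [r j = 2 ^ (k + j)] for [j <= N], and [C] is independent of the
    solution.  The recursion is run on [S j = kap + source_integral de (r j)],
    whose initial value is at least [kap]. *)
Lemma lifespan_steps (T : \bar R) (u v : R -> 'rV[R]_n -> R) (p C kap : R) (k N : nat) :
  (0 < n)%N -> 1 <= p -> p <= 2 -> p = 1 + 2 / n%:R ->
  0 < C -> young_constant n C ->
  (0 < T)%E -> C1_L2 T u v -> damped_wave_eq p T u ->
  0 < kap -> (forall j, (k <= j)%N -> kap < mass v (2 ^+ j) 0 + mass u (2 ^+ j) 0) ->
  ((2 * (2 ^+ (k + N)) ^+ 2)%:E < T)%E ->
  N%:R * ((2 * (2 * scale_const n C) `^ (2 / n%:R))^-1 * (2 / n%:R)) <=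
    kap `^ (- (2 / n%:R)).
Proof.
move=> n0 p1 p2 pE C0 Cy T0 uv weq kap0 kapw rT.
have nR : 0 < n%:R :> R by rewrite ltr0n.
have A0 : 0 < scale_const n C by exact: scale_const_gt0.
pose r j : R := 2 ^+ (k + j).
have r_gt0 j : 0 < r j by rewrite /r exprn_gt0.
have cw j : {within time_interval T,
    continuous (fun t => mass v (r j) t + mass u (r j) t)}.
  by apply: within_add; [exact: (continuous_mass_dt uv)|exact: (continuous_mass uv)].
have [e e0 He] := initial_layers N T0 cw (fun j => kapw (k + j)%N (leq_addr _ _)).
(* With [2 de < 1] the onset is complete before any time cutoff starts to decay. *)
pose de := Num.min (e / 2) (1 / 4).
have de0 : 0 < de by rewrite /de lt_min; apply/andP; split; lra.
have dee : de < e.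
  have : de <= e / 2 by rewrite /de ge_min lexx.
  lra.
have de1 : 2 * de < 1.
  have : de <= 1 / 4 by rewrite /de ge_min lexx orbT.
  lra.
have [X XE X0] : exists2 X : nat -> R,
    forall j, source_integral T u p de (r j) = X j & forall j, 0 <= X j.
  exists (fun j => source_integral T u p de (r j)) => // j.
  apply: Rintegral_ge0 => t _; rewrite mulr_ge0 ?onset_ge0// mulr_ge0 ?cutoff_ge0//.
  by apply: Rintegral_ge0 => x _; rewrite mulr_ge0 ?powR_ge0 ?space_cut_ge0.
pose S j := kap + X j.
have S0 j : 0 < S j by rewrite /S ltr_wpDr.
have key j : (j < N)%N ->
    (2 * (2 * scale_const n C) `^ (2 / n%:R))^-1 * S j.+1 `^ (1 + 2 / n%:R) <= S j.+1 - S j.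
  move=> jN; apply: young_optimize => // th th0.
  have r1 : 1 <= r j.+1 by rewrite /r exprn_ege1// ler1n.
  have rjT : ((2 * r j.+1 ^+ 2)%:E < T)%E.
    apply: le_lt_trans rT; rewrite lee_fin ler_wpM2l//.
    apply: lerXn2r; rewrite ?nnegrE ?exprn_ge0//.
    by rewrite /r ler_weXn2l ?ler1n// leq_add2l.
  have th'0 : 0 < r j.+1 ^+ 2 * th / C by rewrite divr_gt0// mulr_gt0// exprn_gt0.
  have := wave_ineq n0 p1 p2 uv weq C0 Cy pE r1 de0 de1 rjT th'0.
  rewrite rescale_young// (_ : r j.+1 / 2 = r j); last first.
    by rewrite /r addnS exprS mulrC mulKf.
  rewrite !XE => H; have H2 := He de de0 dee j.+1 jN.
  rewrite /S opprD addrACA subrr add0r; apply: le_trans H.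
  by rewrite addrC lerD2l.
apply: (le_trans (backward_euler_bound _ _ (fun j _ => S0 j) key)).
- by rewrite invr_gt0 mulr_gt0// powR_gt0// mulr_gt0.
- by rewrite divr_gt0.
rewrite !powRN lef_pV2 ?posrE ?powR_gt0//.
by rewrite ge0_ler_powR ?nnegrE ?(ltW kap0) ?(ltW (S0 _)) ?divr_ge0// /S lerDl.
Qed.

Lemma pow2_le_expR (m : nat) : 2 * (2 ^+ m) ^+ 2 <= expR (1 + 2 * m%:R) :> R.
Proof.
have e2 : 2 <= expR 1 :> R by have := expR_ge1Dx (1 : R); lra.
rewrite -exprM -exprS (_ : 1 + 2 * m%:R = (m * 2)%N.+1%:R * 1 :> R); last first.
  by rewrite mulr1 -[(m * 2)%N.+1]addn1 natrD natrM; ring.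
by rewrite expRM_natl lerXn2r ?nnegrE ?expR_ge0.
Qed.

End Lifespan.

Theorem theorem1p2 (R : realType) (n : nat) (hn : (4 <= n)%N)
    (p : R) (hp : p = 1 + 2 / n%:R)
    (f g : 'rV[R]_n -> R) (hf : H1 f) (hg : L2 g)
    (hsupp : ess_supp f `|` ess_supp g `<=` [set x | enorm x <= 1])
    (f_ge0 : {ae lebesgue_rV R n, forall x, 0 <= f x})
    (g_ge0 : {ae lebesgue_rV R n, forall x, 0 <= g x})
    (f_neq0 : ~ {ae lebesgue_rV R n, forall x, f x = 0})
    (g_neq0 : ~ {ae lebesgue_rV R n, forall x, g x = 0}) :
  exists eps0 C : R, [/\ 0 < eps0, 0 < C &
    forall eps : R, 0 < eps -> eps <= eps0 ->
    forall (T : \bar R) (u : R -> 'rV[R]_n -> R),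
      solves_cauchy p (fun x => eps * f x) (fun x => eps * g x) T u ->
      (T <= (expR (C * eps `^ (- (2 / n%:R))))%:E)%E].
Proof.
have n0 : (0 < n)%N by apply: leq_trans hn.
have nR : 0 < n%:R :> R by rewrite ltr0n.
have p1 : 1 <= p by rewrite hp lerDl divr_ge0// ltW.
have p2 : p <= 2.
  have : 2 / n%:R <= 1 :> R by rewrite ler_pdivrMr// mul1r ler_nat; apply: leq_trans hn.
  by rewrite hp; lra.
have fL : f \in Lfun (lebesgue_rV R n) 2%:E by case: hf.
have gL : g \in Lfun (lebesgue_rV R n) 2%:E by [].
have [k I0] := exists_positive_mass fL f_ge0 f_neq0.
set I := (X in 0 < X) in I0.
have [C C0 Cy] := @wave_op_young R n n0.
pose c0 : R := (2 * (2 * scale_const n C) `^ (2 / n%:R))^-1 * (2 / n%:R).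
have c00 : 0 < c0.
  by rewrite mulr_gt0 ?divr_gt0// invr_gt0 mulr_gt0// powR_gt0// mulr_gt0// scale_const_gt0.
pose K := (I / 2) `^ (- (2 / n%:R)) / c0.
have K0 : 0 < K by rewrite divr_gt0// powR_gt0// divr_gt0.
(* For [eps <= 1] the additive terms [2 k + 3] are absorbed by
   [eps ^ (- 2 / n)], which is then at least 1. *)
exists 1, (2 * K + 2 * k%:R + 3); split => //.
  by have := ler0n R k; lra.
move=> eps eps0 eps1 T u [T0 _ [v [uv u0 v0]] weq _].
have E1 : 1 <= eps `^ (- (2 / n%:R)).
  rewrite powRN invf_ge1 ?powR_gt0//.
  apply: (@le_trans _ _ (1 `^ (2 / n%:R))); last by rewrite powR1.
  by rewrite ge0_ler_powR ?nnegrE ?divr_ge0 ?(ltW eps0)// ltW.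
rewrite leNgt; apply/negP => longT.
set E := eps `^ _ in E1 longT.
(* One step more than the recursion allows. *)
pose N := (Num.trunc (K * E)).+1.
have KE0 : 0 <= K * E by rewrite mulr_ge0 ?(ltW K0)// (le_trans _ E1).
have /andP[NKE KEN] : (N%:R <= K * E + 1) && (K * E < N%:R).
  have /andP[h1 h2] := truncn_itv KE0.
  by rewrite /N h2 andbT -natr1 lerD2r.
have u0L : u 0 \in Lfun (lebesgue_rV R n) 2%:E.
  by case: uv => cu _ _; case: (cu 0).
have v0L : v 0 \in Lfun (lebesgue_rV R n) 2%:E.
  by case: uv => _ cv _; case: (cv 0).
have kapw j : (k <= j)%N -> eps * I / 2 < mass v (2 ^+ j) 0 + mass u (2 ^+ j) 0.
  move=> kj; rewrite /mass (mass_ae_scale j gL v0L v0) (mass_ae_scale j fL u0L u0).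
  have g0 : 0 <= \int[lebesgue_rV R n]_x (g x * space_cut (2 ^+ j) x).
    apply: ae_Rintegral_ge0.
      by apply: measurable_funM; [exact: Lfun2_measurable gL|exact: measurable_space_cut].
    by apply: filterS g_ge0 => x gx; rewrite mulr_ge0// space_cut_ge0.
  have fI := mass_mono kj fL f_ge0; rewrite -/I in fI.
  have eI : 0 < eps * I by rewrite mulr_gt0.
  have := ler_wpM2l (ltW eps0) fI; have := mulr_ge0 (ltW eps0) g0.
  lra.
have longN : ((2 * (2 ^+ (k + N)) ^+ 2)%:E < T)%E.
  apply: le_lt_trans longT; rewrite lee_fin.
  apply: (le_trans (pow2_le_expR R (k + N))); rewrite ler_expR natrD.
  have kE : 0 <= k%:R * (E - 1) by rewrite mulr_ge0// subr_ge0.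
  lra.
have kap0 : 0 < eps * I / 2 by rewrite divr_gt0// mulr_gt0.
have := lifespan_steps n0 p1 p2 hp C0 Cy T0 uv weq kap0 kapw longN.
rewrite -/c0.
have -> : (eps * I / 2) `^ (- (2 / n%:R)) = K * E * c0.
  rewrite -mulrA powRM ?divr_ge0 ?(ltW eps0) ?(ltW I0)//.
  by rewrite /K /E mulrAC divfK ?gt_eqF// mulrC.
by rewrite ler_pM2r// leNgt KEN.
Qed.
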